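(* Let $n\ge 1$ and let $w_0$ be any maximal element of the poset $\mathrm{Weak}(F_n)$. Then the interval $[e,w_0]=\{u\in F_n : u\le w_0\}$ of $\mathrm{Weak}(F_n)$ is isomorphic, as a poset, to the weak order on the symmetric group $S_{n-1}$. (That is, each maximal interval in $\mathrm{Weak}(F_n)$ is isomorphic to the weak order on $S_{n-1}$.)
   Context: $S_n$ is the symmetric group on $\{1,\dots,n\}$, with product $(\pi\sigma)(i)=\pi(\sigma(i))$; $(a,b)$ denotes a transposition, and $T$ is the set of all transpositions in $S_n$. Let $c=(1,2,\dots,n)$ be the $n$-cycle. $NC(n)=\{\pi\in S_n:\ \ell_T(\pi)+\ell_T(\pi^{-1}c)=\ell_T(c)\}$, where $\ell_T(\pi)$ is the minimal number of factors in an expression of $\pi$ as a product of transpositions, ordered by $\pi\le\sigma\iff \ell_T(\pi)+\ell_T(\pi^{-1}\sigma)=\ell_T(\sigma)$. $F_n$ is the set of maximal chains of $NC(n)$; it is identified with the set of words $(t_1,\dots,t_{n-1})$ of transpositions with $t_1t_2\cdots t_{n-1}=c$, the word corresponding to the chain $id<t_1<t_1t_2<\cdots<c$ (for $n=1$, $F_1$ consists of the empty word, and $S_0$ is the trivial group). For $1\le i\le n-2$ and $v=(t_1,\dots,t_{n-1})\in F_n$, $R_i(v)$ is obtained from $v$ by replacing $(t_i,t_{i+1})$ by $(t_{i+1}^{t_i},t_i)$, and $L_i(v)$ by replacing $(t_i,t_{i+1})$ by $(t_{i+1},t_i^{t_{i+1}})$, where $g^h=h^{-1}gh$. The Hurwitz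 graph $G_T(n)$ is the undirected graph with vertex set $F_n$, two chains being adjacent if they differ in exactly one element; equivalently, $u,v$ are adjacent iff $v=R_i(u)$ or $v=L_i(u)$ for some $i$ (and $u\neq v$). It is connected. Put $e=((1,2),(2,3),\dots,(n-1,n))\in F_n$. The poset $\mathrm{Weak}(F_n)$ is $F_n$ with the order: $u\le v$ iff $u$ lies on a geodesic in $G_T(n)$ from $e$ to $v$. Its unique minimal element is $e$. The (right) weak order on $S_m$ is with respect to the simple transpositions $s_j=(j,j+1)$: it is the order whose covering relations are $\pi<\pi s_j$ whenever $\mathrm{inv}(\pi s_j)=\mathrm{inv}(\pi)+1$, where $\mathrm{inv}$ is the number of inversions. *)

(* Defs.v *)
From mathcomp Require Import all_boot all_fingroup.

Set Implicit Arguments.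
Unset Strict Implicit.
Unset Printing Implicit Defensive.

Local Open Scope group_scope.

(* Permutations act on 'I_n = {0, .., n-1} instead of {1, .., n}.             *)

(* The product (pi sigma)(i) = pi (sigma i); the group law of {perm 'I_n}     *)
(* composes the other way: (s * t) i = t (s i).                               *)
Definition pmul (n : nat) (pi sigma : 'S_n) : 'S_n := sigma * pi.

Definition pprod (n : nat) (w : seq 'S_n) : 'S_n := foldr (@pmul n) 1 w.

Definition is_transp (n : nat) (t : 'S_n) : bool :=
  [exists a : 'I_n, exists b : 'I_n, (a != b) && (t == tperm a b)].

Definition is_length (n : nat) (pi : 'S_n) (k : nat) : bool :=
  [exists w : k.-tuple 'S_n, all (@is_transp n) w && (pprod w == pi)].

Lemma is_length_ex (n : nat) (pi : 'S_n) : exists k, is_length pi k.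
Proof.
have [ts -> ts_d] := prod_tpermP pi.
exists (size ts); apply/existsP.
pose w := rev [seq tperm t.1 t.2 | t <- ts].
have size_w : size w == size ts by rewrite size_rev size_map.
exists (Tuple size_w); rewrite /= /w all_rev all_map.
apply/andP; split.
  apply/allP=> t /(allP ts_d) t_d /=.
  by apply/existsP; exists t.1; apply/existsP; exists t.2; apply/andP.
have pprod_rcons s (x : 'S_n) : pprod (rcons s x) = x * pprod s.
  elim: s => [|y s IHs] /=; first by rewrite /pmul mulg1 mul1g.
  by rewrite IHs /pmul mulgA.
apply/eqP; elim: {ts_d w size_w} ts => [|t ts IHts]; first by rewrite big_nil.
by rewrite big_cons /= rev_cons pprod_rcons IHts.
Qed.

Definition ell_T (n : nat) (pi : 'S_n) : nat := ex_minn (is_length_ex pi).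

Definition abs_le (n : nat) (pi sigma : 'S_n) : bool :=
  ell_T pi + ell_T (pmul pi^-1 sigma) == ell_T sigma.

(* The n-cycle c = (1, 2, .., n): ordS is the cyclic successor on 'I_n.       *)
Definition long_cycle (n : nat) : 'S_n := perm (@ordS_inj n).

Definition NC (n : nat) : {set 'S_n} := [set pi | abs_le pi (long_cycle n)].

Definition is_chain (n : nat) (C : {set 'S_n}) : bool :=
  (C \subset NC n) &&
  [forall x in C, forall y in C, abs_le x y || abs_le y x].

(* F_n: a chain is represented by the set of its elements; the word           *)
(* (t_1, .., t_{n-1}) is recovered from the quotients of consecutive elements. *)
Definition max_chains (n : nat) : {set {set 'S_n}} :=
  [set C | maxset (@is_chain n) C].

(* All maximal chains have n elements, so differing in exactly one element    *)
(* means that both differences are singletons.                                *)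
Definition hurwitz_adj (n : nat) : rel {set 'S_n} := fun u v =>
  [&& u \in max_chains n, v \in max_chains n,
      #|u :\: v| == 1%N & #|v :\: u| == 1%N].

(* The transposition exchanging j and j+1 (no wrap-around, as j < n-1).       *)
Definition simple_transp (n : nat) (j : 'I_n.-1) : 'S_n :=
  let i := widen_ord (leq_pred n) j in tperm i (ordS i).

(* The set {id, t_1, t_1 t_2, .., t_1 .. t_k} of a word (t_1, .., t_k).       *)
Definition chain_of_word (n : nat) (w : seq 'S_n) : {set 'S_n} :=
  [set x in 1 :: scanl (@pmul n) 1 w].

Definition e_chain (n : nat) : {set 'S_n} :=
  chain_of_word [seq @simple_transp n j | j <- enum 'I_n.-1].

(* The first vertex of the walk x :: p is not stored in p.                    *)
Definition geodesic (T : eqType) (r : rel T) (x y : T) (p : seq T) : Prop :=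
  [/\ path r x p, last x p = y
    & forall q : seq T, path r x q -> last x q = y -> size p <= size q].

Definition weakF_le (n : nat) (u v : {set 'S_n}) : Prop :=
  exists2 p : seq {set 'S_n},
    geodesic (@hurwitz_adj n) (e_chain n) v p & u \in e_chain n :: p.

Definition weakF_maximal (n : nat) (w : {set 'S_n}) : Prop :=
  w \in max_chains n /\
  forall v : {set 'S_n}, v \in max_chains n -> weakF_le w v -> v = w.

Definition inversions (m : nat) (pi : 'S_m) : nat :=
  #|[set ij : 'I_m * 'I_m | (ij.1 < ij.2) && (pi ij.2 < pi ij.1)]|.

Definition weak_cover (m : nat) : rel 'S_m := fun pi sigma =>
  [exists j : 'I_m.-1, (sigma == pmul pi (@simple_transp m j)) &&
    (inversions sigma == (inversions pi).+1)].

Definition weak_le (m : nat) : rel 'S_m := connect (@weak_cover m).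

(* f is an isomorphism from the poset (T, leT) onto the subset I of U ordered *)
(* by leU.                                                                    *)
Definition poset_iso_onto (T U : Type) (leT : T -> T -> Prop)
    (leU : U -> U -> Prop) (I : U -> Prop) (f : T -> U) : Prop :=
  [/\ injective f,
      forall u : U, I u <-> exists x : T, f x = u
    & forall x y : T, leT x y <-> leU (f x) (f y)].

(* Main.v *)
Require Import Defs.
From mathcomp Require Import all_boot all_fingroup.
From mathcomp Require Import zify.

(** Write n = m.+1 and attach to a permutation x the set excv x of its
    excedance values, the i with x^-1 i < i.  The cycles of a noncrossing
    partition are increasing, so excv x collects the elements of the blocks that
    are not the minimum of their block.  A transposition adds at most one
    element to excv (excv_tpermM) and the long cycle has m of them; hence along a
    factorization of the long cycle into m transpositions excv gains exactly one
    element at each step.  That element is the label of the step, and the labels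
    of a maximal chain form a permutation of {1, .., m}, which is increasing for
    the chain e alone (ascending_unique).

    Two adjacent chains differ at one rank, where the two labels around that rank
    are either kept or swapped (agree_label).  A swap can always be performed
    (ascent_exchange, descent_exchange), and the chain that is ascending at
    that rank is unique (ascent_unique).  So an edge of the Hurwitz graph changes
    the number of inversions of the labels by at most one, every chain other than
    e has a neighbour with one inversion less, and the distance from e is the
    number of inversions.  Therefore Weak(F_n) is generated by the edges that
    create one inversion (weakF_leE), and the labels of a maximal element decrease
    (maximal_descending).

    A chain w0 with labels m, m - 1, .., 1 is the same as a noncrossing tree in
    which every j > 0 has a parent p j < j: the step labelled j hangs the block of
    j below p j.  Keeping only the edges (p j, j) with j in a set S of labels
    yields a noncrossing partition whose excedance values are exactly S
    (forest_excvE), and enlarging S by one element multiplies it by a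
    transposition (forest_setU1); this embeds the Boolean lattice of subsets of
    {1, .., m} into NC(n).  A permutation s of the labels becomes the maximal chain
    through the forests of the initial segments of s.  The number of inversions is
    preserved, and exchanging two consecutive values of s is an edge of the
    Hurwitz graph.  By uniqueness of ascents everything below such a chain is such
    a chain (weak_coverF_chain), while a permutation without ascents gives w0
    itself (perm_chain_top).  So [e, w0] is the set of these chains, ordered as
    the weak order. *)

Set Implicit Arguments.
Unset Strict Implicit.
Unset Printing Implicit Defensive.

(** * Absolute length and absolute order *)

Lemma pprod_cat n (v w : seq 'S_n) :
  Defs.pprod (v ++ w) = (Defs.pprod w * Defs.pprod v)%g.
Proof.
elim: v => [|t v IHv] /=; first by rewrite mulg1.
by rewrite IHv /pmul mulgA.
Qed.

Lemma is_transp_tperm n (a b : 'I_n) : a != b -> is_transp (tperm a b).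
Proof.
by move=> ab; apply/existsP; exists a; apply/existsP; exists b; rewrite ab eqxx.
Qed.

Lemma is_transpP n (t : 'S_n) : is_transp t -> exists a b, t = tperm a b.
Proof. by case/existsP=> a /existsP[b /andP[_ /eqP->]]; exists a, b. Qed.

Lemma ell_word n (x : 'S_n) :
  exists w, [/\ all (@is_transp n) w, Defs.pprod w = x & size w = ell_T x].
Proof.
rewrite /ell_T; case: ex_minnP => k /existsP[w /andP[w_t /eqP w_x]] _.
by exists w; rewrite size_tuple.
Qed.

Lemma ell_pprod n (w : seq 'S_n) :
  all (@is_transp n) w -> ell_T (Defs.pprod w) <= size w.
Proof.
move=> w_t; rewrite /ell_T; case: ex_minnP => k _ -> //.
by apply/existsP; exists (in_tuple w); rewrite w_t eqxx.
Qed.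

Lemma ellM n (x y : 'S_n) : ell_T (x * y)%g <= ell_T x + ell_T y.
Proof.
have [v [v_t <- <-]] := ell_word x; have [w [w_t <- <-]] := ell_word y.
by rewrite -pprod_cat addnC -size_cat ell_pprod // all_cat w_t.
Qed.

Lemma ell_triangle n (x y z : 'S_n) :
  ell_T (z * x^-1)%g <= ell_T (z * y^-1)%g + ell_T (y * x^-1)%g.
Proof. by rewrite (leq_trans _ (ellM _ _)) // mulgA mulgKV. Qed.

Lemma ell_mulgV n (x y : 'S_n) : ell_T y <= ell_T (y * x^-1)%g + ell_T x.
Proof. by rewrite (leq_trans _ (ellM _ _)) // mulgKV. Qed.

Lemma ell1 n : ell_T (1 : 'S_n)%g = 0.
Proof. by apply/eqP; rewrite -leqn0 (@ell_pprod n [::]). Qed.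

Lemma ell_tperm n (a b : 'I_n) : ell_T (tperm a b) <= 1.
Proof.
have [<-|ab] := eqVneq a b; first by rewrite tperm1 ell1.
have := @ell_pprod n [:: tperm a b]; rewrite /= is_transp_tperm //=.
by rewrite /pmul mul1g => ->.
Qed.

Lemma ell_eq0 n (x : 'S_n) : ell_T x = 0 -> x = 1%g.
Proof. by have [w [_ <- <-]] := ell_word x; case: w. Qed.

Lemma ell_eq1 n (x : 'S_n) : ell_T x = 1 -> exists a b, x = tperm a b.
Proof.
have [w [w_t <- <-]] := ell_word x; case: w w_t => [|t [|u w]] //= w_t _.
by rewrite /pmul mul1g; apply: is_transpP; case/andP: w_t.
Qed.

Lemma ell_tpermM n (a b : 'I_n) (x : 'S_n) :
  ell_T (tperm a b * x)%g <= (ell_T x).+1.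
Proof. by rewrite (leq_trans (ellM _ _)) // -add1n leq_add2r ell_tperm. Qed.

Lemma abs_leE n (x y : 'S_n) :
  abs_le x y = (ell_T x + ell_T (y * x^-1)%g <= ell_T y).
Proof.
by rewrite /abs_le /pmul; have := ell_mulgV x y; lia.
Qed.

Lemma abs_le_ell n (x y : 'S_n) :
  abs_le x y -> ell_T (y * x^-1)%g = ell_T y - ell_T x.
Proof. by move/eqP; rewrite /pmul; lia. Qed.

Lemma abs_le_refl n : reflexive (@abs_le n).
Proof. by move=> x; rewrite abs_leE mulgV ell1 addn0. Qed.

Lemma abs_le1 n (x : 'S_n) : abs_le 1 x.
Proof. by rewrite abs_leE invg1 mulg1 ell1. Qed.

Lemma abs_le_leq n (x y : 'S_n) : abs_le x y -> ell_T x <= ell_T y.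
Proof. by move/eqP; lia. Qed.

Lemma abs_le_trans n : transitive (@abs_le n).
Proof.
move=> y x z; by rewrite !abs_leE; have := ell_triangle x y z; lia.
Qed.

Lemma abs_le_eq n (x y : 'S_n) : abs_le x y -> ell_T y <= ell_T x -> x = y.
Proof.
move/abs_le_ell=> xy yx; have {xy} : ell_T (y * x^-1)%g = 0 by lia.
by move/ell_eq0/eqP; rewrite -eq_mulgV1 => /eqP.
Qed.

(** Multiply x by the first transposition of a shortest word for y * x^-1. *)
Lemma abs_le_cover n (x y : 'S_n) : abs_le x y -> ell_T x < ell_T y ->
  exists z, [/\ abs_le x z, abs_le z y & ell_T z = (ell_T x).+1].
Proof.
move=> xy lt_xy; have := abs_le_ell xy.
have [[|t w] [/= w_t w_y <-]] := ell_word (y * x^-1)%g; first by lia.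
case/andP: w_t => /is_transpP[a [b ab]] w_t sz.
have t_le1 : ell_T t <= 1 by rewrite ab ell_tperm.
have [z z_def] : exists z, z = (t * x)%g by exists (t * x)%g.
have zx : (z * x^-1 = t)%g by rewrite z_def mulgK.
have yz : (y * z^-1 = Defs.pprod w)%g.
  by apply: (canLR (mulgK z)); rewrite z_def mulgA -/(pmul t _) w_y mulgKV.
have := ellM t x; rewrite -z_def => zle; exists z; rewrite !abs_leE zx yz.
have := ell_pprod w_t; have := ell_mulgV z y; rewrite yz.
by move: sz => /=; move: (size w) => r *; split; lia.
Qed.

(** * Excedance values *)

Definition excv n (x : 'S_n) : {set 'I_n} := [set i | x^-1%g i < i].

Lemma invM_tperm n (a b i : 'I_n) (x : 'S_n) :
  (tperm a b * x)^-1%g i = tperm a b (x^-1%g i).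
Proof. by rewrite invMg permM tpermV. Qed.

(** Multiplying by tperm a b exchanges the preimages of x a and x b.  As a <= b,
    the preimage of x a can only increase, so that only x b can become an
    excedance value. *)
Lemma excv_tpermM n (a b : 'I_n) (x : 'S_n) :
  a <= b -> excv (tperm a b * x)%g \subset x b |: excv x.
Proof.
move=> le_ab; apply/subsetP=> i; rewrite !inE invM_tperm.
case: tpermP => [->|<-|_ _ ->]; last by rewrite orbT.
- by move=> lt_bi; rewrite (leq_ltn_trans le_ab) ?orbT.
- by rewrite permKV eqxx.
Qed.

Lemma excv_tperm_sub n (a b : 'I_n) (x : 'S_n) :
  exists i, excv (tperm a b * x)%g \subset i |: excv x.
Proof.
have [ab|/ltnW ab] := leqP a b; first by exists (x b); apply: excv_tpermM.
by exists (x a); rewrite tpermC; apply: excv_tpermM.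
Qed.

Lemma card_excv_tpermM n (a b : 'I_n) (x : 'S_n) :
  #|excv (tperm a b * x)%g| <= #|excv x|.+1.
Proof.
have [i /subset_leq_card/leq_trans-> //] := excv_tperm_sub a b x.
by rewrite cardsU1; case: (_ \notin _).
Qed.

Lemma excv1 n : excv (1 : 'S_n)%g = set0.
Proof. by apply/setP=> i; rewrite !inE invg1 perm1 ltnn. Qed.

(** Applied with x = 1 this bounds the absolute length from below without
    counting cycles. *)
Lemma card_excv_ell n (x y : 'S_n) :
  #|excv y| <= #|excv x| + ell_T (y * x^-1)%g.
Proof.
have [w [w_t w_y <-]] := ell_word (y * x^-1)%g.
have -> : y = (Defs.pprod w * x)%g by rewrite w_y mulgKV.
elim: w x w_t {w_y} => [|t w IHw] x /=; first by rewrite mul1g addn0.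
case/andP=> /is_transpP[a [b ->]] /IHw; rewrite /pmul -mulgA => /(_ _)/leq_trans.
by apply; rewrite addnS -addSn leq_add2r card_excv_tpermM.
Qed.

Lemma ord0_excv m (x : 'S_m.+1) : ord0 \notin excv x.
Proof. by rewrite inE. Qed.

Lemma excv_long_cycle m : excv (long_cycle m.+1) = ~: [set ord0].
Proof.
apply/setP=> i; rewrite !inE; have [->|i0] := eqVneq i ord0; first by rewrite ltn0.
pose j : 'I_m.+1 := inord i.-1.
have i_gt0 : 0 < i by rewrite lt0n.
have vj : j = i.-1 :> nat by rewrite inordK //; have := ltn_ord i; lia.
have -> : i = long_cycle m.+1 j.
  by apply: val_inj; rewrite permE /= vj prednK // modn_small.
by rewrite permK permE /= vj prednK // modn_small //; lia.
Qed.

Lemma card_excv_long_cycle m : #|excv (long_cycle m.+1)| = m.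
Proof. by rewrite excv_long_cycle cardsC1 card_ord. Qed.

Lemma eq_setU1 (T : finType) (A B : {set T}) (i : T) :
  B \subset i |: A -> #|B| = #|A|.+1 -> i \notin A /\ B = i |: A.
Proof.
move=> sBA cB; have := subset_leq_card sBA; rewrite cardsU1 cB => le_A.
have iA : i \notin A by case: (i \in A) le_A; rewrite //= add0n ltnn.
by split=> //; apply/eqP; rewrite eqEcard sBA cardsU1 iA cB add1n leqnn.
Qed.

(** Within NC(n) these are the cover relations, i being the label of the edge. *)
Definition excv_step n (x : 'S_n) (i : 'I_n) (y : 'S_n) : Prop :=
  [/\ exists a b, y = (tperm a b * x)%g, i \notin excv x
    & excv y = i |: excv x].

Lemma excv_stepP n (x : 'S_n) (a b : 'I_n) : a <= b ->
  #|excv (tperm a b * x)%g| = #|excv x|.+1 ->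
  excv_step x (x b) (tperm a b * x)%g.
Proof.
move=> le_ab /(eq_setU1 (excv_tpermM x le_ab))[xb yE].
by split=> //; exists a, b.
Qed.

Lemma excv_step_ex n (x : 'S_n) (a b : 'I_n) :
  #|excv (tperm a b * x)%g| = #|excv x|.+1 ->
  exists i, excv_step x i (tperm a b * x)%g.
Proof.
have [ab|/ltnW ba] := leqP a b => cE; first by exists (x b); apply: excv_stepP.
by exists (x a); move: cE; rewrite tpermC => cE; apply: excv_stepP.
Qed.

Lemma card_excv_step n (x y : 'S_n) i :
  excv_step x i y -> #|excv y| = #|excv x|.+1.
Proof. by case=> _ xi ->; rewrite cardsU1 xi. Qed.

(** A labelled step is determined by the preimages of its label: i can only
    become an excedance value by being sent from x^-1 i >= i to y^-1 i < i. *)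
Lemma excv_step_tperm n (x y : 'S_n) i : excv_step x i y ->
  [/\ y^-1%g i < i, i <= x^-1%g i & y = (tperm (y^-1%g i) (x^-1%g i) * x)%g].
Proof.
case=> -[a [b y_def]] xi yE.
have lt_yi : y^-1%g i < i by have := setU11 i (excv x); rewrite -yE inE.
have le_ix : i <= x^-1%g i by rewrite inE -leqNgt in xi.
split=> //; rewrite {1}y_def; congr (_ * _)%g.
move: lt_yi; rewrite y_def !invM_tperm.
by case: tpermP => [->|->|_ _] lt_yi; rewrite 1?tpermC //; move: lt_yi le_ix; lia.
Qed.

(** A step labelled j moves the preimages of j and of one other value, and it
    sends the preimage of that other value to x^-1 j >= j.  An excedance value
    i < j cannot be that other value, as it remains an excedance value. *)
Lemma excv_step_keep n (x y : 'S_n) (i j : 'I_n) :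
  excv_step x j y -> i \in excv x -> i < j -> y^-1%g i = x^-1%g i.
Proof.
move=> xy xi lt_ij; have [lt_yj le_jx y_def] := excv_step_tperm xy.
have : i \in excv y by case: xy => _ _ ->; rewrite !inE in xi *; rewrite xi orbT.
rewrite inE; rewrite {1 2}y_def invM_tperm; case: tpermP => //.
  by move=> _; lia.
by move/perm_inj=> eq_ij; rewrite eq_ij ltnn in lt_ij.
Qed.

(** In an interval of rank two, the middle of a chain with increasing labels
    depends only on the ends: its first step is determined by the preimage
    of i, which the second step does not change. *)
Lemma ascent_unique n (x m y : 'S_n) (i j : 'I_n) : i < j ->
  excv_step x i m -> excv_step m j y ->
  m = (tperm (y^-1%g i) (x^-1%g i) * x)%g.
Proof.
move=> lt_ij xm my; have [_ _ {1}->] := excv_step_tperm xm.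
by rewrite (excv_step_keep my) //; case: xm => _ _ ->; rewrite setU11.
Qed.

(** The label of a first step can be read off the larger point of its
    transposition; counting then forces the label of the second step. *)
Lemma excv_step2 n (x m y : 'S_n) (i j : 'I_n) (a b c d : 'I_n) :
  excv y = j |: (i |: excv x) -> #|excv y| = #|excv x|.+2 ->
  m = (tperm a b * x)%g -> y = (tperm c d * m)%g -> a <= b -> x b = i ->
  excv_step x i m /\ excv_step m j y.
Proof.
move=> yE cy m_def y_def le_ab xb.
have xm : excv_step x i m.
  rewrite -xb m_def; apply: excv_stepP => //; apply/eqP; rewrite eqn_leq.
  rewrite card_excv_tpermM /= -ltnS -cy -m_def y_def.
  by rewrite card_excv_tpermM.
split=> //; have [_ _ mE] := xm.
have [//||j_m _] := @eq_setU1 _ (excv m) (excv y) j.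
- by rewrite mE yE.
- by rewrite cy (card_excv_step xm).
by split=> //; [exists c, d | rewrite yE mE].
Qed.

Lemma tperm_conj (T : finType) (x y z w : T) :
  (tperm x y * tperm z w =
     tperm (tperm x y z) (tperm x y w) * tperm x y)%g.
Proof. by rewrite -(tpermJ z w (tperm x y)) conjgE tpermV -!mulgA tperm2 mulg1. Qed.

(** The new first step must have transposition (y^-1 i, x^-1 i).  Its second
    point is the preimage of i under m, unless the step labelled j has moved it;
    a conjugation moves the other transposition to the second step. *)
Lemma descent_exchange n (x m y : 'S_n) (i j : 'I_n) : i < j ->
  excv_step x j m -> excv_step m i y ->
  exists m', excv_step x i m' /\ excv_step m' j y.
Proof.
move=> lt_ij xm my; have cy := card_excv_step my; rewrite (card_excv_step xm) in cy.
have [_ xj mE] := xm; have [_ mi yE] := my.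
rewrite mE setUCA in yE.
have le_ix : i <= x^-1%g i.
  by rewrite leqNgt; apply: contra mi; rewrite mE !inE => ->; rewrite orbT.
have [_ _] := excv_step_tperm xm; set a := (m^-1%g j); set b := (x^-1%g j) => m_def.
have [] := excv_step_tperm my; set a' := (y^-1%g i).
rewrite m_def invM_tperm -/b.
case: tpermP => [xi|/perm_inj eq_ij|_ _].
(* The first step has moved the preimage of i from a to b. *)
- move=> lt_i le_i y_def; exists (tperm a' a * x)%g.
  apply: (@excv_step2 _ _ _ _ i j a' a a b) => //.
  + rewrite y_def !mulgA; congr (_ * _)%g; rewrite [RHS]tperm_conj tpermL.
    rewrite tpermC [in RHS]tpermD ?[tperm b a']tpermC //.
    * by apply/eqP=> eq_a; move: lt_i; rewrite -eq_a -xi; lia.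
    * by apply/eqP=> eq_a; move: lt_i; rewrite -eq_a; lia.
  + by rewrite -xi; lia.
  + by rewrite -xi permKV.
- by rewrite eq_ij ltnn in lt_ij.
(* The first step has left the preimage of i in place. *)
- set b' := (x^-1%g i) => lt_i le_i y_def; exists (tperm a' b' * x)%g.
  apply: (@excv_step2 _ _ _ _ i j a' b' (tperm a' b' a) (tperm a' b' b)) => //.
  + by rewrite y_def !mulgA; congr (_ * _)%g; rewrite tperm_conj.
  + by lia.
  + by rewrite permKV.
Qed.

(** Commuting the two transpositions, up to a conjugation, gives another middle
    element m'.  It cannot carry the labels in the order i, j, because the
    ascending middle element is unique. *)
Lemma ascent_exchange n (x m y : 'S_n) (i j : 'I_n) : i < j ->
  excv_step x i m -> excv_step m j y ->
  exists m', excv_step x j m' /\ excv_step m' i y.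
Proof.
move=> lt_ij xm my; have cy := card_excv_step my; rewrite (card_excv_step xm) in cy.
have [[a [b m_def]] xi mE] := xm; have [[c [d y_def]] mj yE] := my.
rewrite mE in yE; have m_uniq := ascent_unique lt_ij xm my.
pose m' := (tperm c d * x)%g.
have y_def' : y = (tperm (tperm c d a) (tperm c d b) * m')%g.
  by rewrite y_def m_def /m' !mulgA; congr (_ * _)%g; rewrite tperm_conj.
have [xj ij] : j \notin excv x /\ j != i.
  by move: mj; rewrite mE !inE negb_or => /andP[].
have [|k xm'] := @excv_step_ex _ x c d; rewrite -/m'.
  apply/eqP; rewrite eqn_leq card_excv_tpermM -ltnS -cy y_def'.
  by rewrite card_excv_tpermM.
have [_ xk m'E] := xm'.
have [l m'y] : exists l, excv_step m' l y.
  by rewrite y_def'; apply: excv_step_ex; rewrite -y_def' cy (card_excv_step xm').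
have [_ m'l yE'] := m'y; rewrite m'E in m'l yE'.
have : k \in excv y by rewrite yE' !inE eqxx orbT.
have : l \in excv y by rewrite yE' setU11.
move: m'l; rewrite yE !inE negb_or => /andP[l_k].
rewrite -ltnNge ltnS leqNgt => /negPf->; rewrite orbF => lE.
move: xk; rewrite inE => /negPf->; rewrite orbF.
case/orP=> /eqP k_def; rewrite k_def {k k_def} in xm' l_k {m'E yE'}.
  exists m'; split=> //; move: m'y.
  by case/orP: lE l_k => /eqP-> //; rewrite eqxx.
case/orP: lE l_k m'y => /eqP->; rewrite ?eqxx // => _ m'y.
(* Here m' = m, so both steps use the same transposition and y = x. *)
have := ascent_unique lt_ij xm' m'y; rewrite -m_uniq m_def /m' => /mulIg cd_ab.
move: cy; rewrite y_def m_def cd_ab mulgA tperm2 mul1g.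
by move/eqP; rewrite -[X in X == _]addn0 -addn2 eqn_add2l.
Qed.

(** * Maximal chains as sequences of permutations *)

(** The word (t_1, .., t_m) is recorded by its partial products.  The group law
    composes from left to right, so that the next transposition of the word
    multiplies on the left.  Allowing a = b costs nothing: the number of
    excedance values excludes it. *)
Definition gallery m (X : nat -> 'S_m.+1) : Prop :=
  [/\ X 0 = 1%g, X m = long_cycle m.+1
    & forall k, k < m -> exists a b, X k.+1 = (tperm a b * X k)%g].

Definition chain_of m (X : nat -> 'S_m.+1) : {set 'S_m.+1} :=
  [set X k | k : 'I_m.+1].

(** The number of excedance values grows by at most one in each of the m steps,
    and it reaches m. *)
Lemma gallery_card m (X : nat -> 'S_m.+1) k :
  gallery X -> k <= m -> #|excv (X k)| = k.
Proof.
case=> X0 Xm XS le_km; apply/eqP; rewrite eqn_leq; apply/andP; split.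
  elim: k le_km => [|k IHk] lt_km; first by rewrite X0 excv1 cards0.
  have [a [b ->]] := XS k lt_km.
  by rewrite (leq_trans (card_excv_tpermM _ _ _)) // ltnS IHk // ltnW.
have bound d : k + d <= m -> #|excv (X (k + d))| <= #|excv (X k)| + d.
  elim: d => [|d IHd]; first by rewrite !addn0.
  rewrite addnS => lt_m; have [a [b ->]] := XS _ lt_m.
  by rewrite (leq_trans (card_excv_tpermM _ _ _)) // addnS ltnS IHd // ltnW.
have := bound (m - k); rewrite subnKC // Xm card_excv_long_cycle => /(_ (leqnn _)).
lia.
Qed.

Lemma gallery_ell m (X : nat -> 'S_m.+1) k :
  gallery X -> k <= m -> ell_T (X k) = k.
Proof.
move=> galX le_km; apply/eqP; rewrite eqn_leq; apply/andP; split.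
  case: galX => X0 _ XS; elim: k le_km => [|k IHk] lt_km; first by rewrite X0 ell1.
  have [a [b ->]] := XS k lt_km.
  by rewrite (leq_trans (ell_tpermM _ _ _)) // ltnS IHk // ltnW.
rewrite -{1}(gallery_card galX le_km).
have := card_excv_ell 1 (X k); rewrite excv1 cards0.
by rewrite (_ : X k * 1^-1 = X k)%g // invg1 mulg1.
Qed.

(** The default value ord0 is never the label of a step of a gallery. *)
Definition label m (X : nat -> 'S_m.+1) k : 'I_m.+1 :=
  odflt ord0 [pick i in excv (X k.+1) :\: excv (X k)].

Lemma label_eq m (X : nat -> 'S_m.+1) k i :
  excv_step (X k) i (X k.+1) -> label X k = i.
Proof.
case=> _ Xi XE; rewrite /label; case: pickP => [j|/(_ i)].
  by rewrite XE !inE => /= /andP[/negPf->]; rewrite orbF => /eqP.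
by rewrite XE in_setD Xi setU11.
Qed.

Lemma gallery_step m (X : nat -> 'S_m.+1) k :
  gallery X -> k < m -> excv_step (X k) (label X k) (X k.+1).
Proof.
move=> galX lt_km.
have [i Xi] : exists i, excv_step (X k) i (X k.+1).
  have [_ _ /(_ k lt_km)[a [b Xk]]] := galX; rewrite Xk; apply: excv_step_ex.
  by rewrite -Xk !gallery_card // ltnW.
by rewrite (label_eq Xi).
Qed.

Lemma gallery_excv_sub m (X : nat -> 'S_m.+1) k l :
  gallery X -> k <= l -> l <= m -> excv (X k) \subset excv (X l).
Proof.
move=> galX; elim: l => [|l IHl]; first by rewrite leqn0 => /eqP->.
rewrite leq_eqVlt ltnS => /orP[/eqP->//|le_kl] lt_lm.
have [_ _ ->] := gallery_step galX lt_lm.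
by rewrite (subset_trans (IHl le_kl (ltnW lt_lm))) ?subsetUr.
Qed.

Lemma label_gt0 m (X : nat -> 'S_m.+1) k : gallery X -> k < m -> 0 < label X k.
Proof.
move=> galX /(gallery_step galX)[_ _ XE]; rewrite lt0n.
have := setU11 (label X k) (excv (X k)); rewrite -XE; apply: contraTneq => lab0.
by rewrite (_ : label X k = ord0) ?ord0_excv //; apply: val_inj.
Qed.

Lemma increasing_eqS (f : nat -> nat) m :
    (forall k, k.+1 < m -> f k < f k.+1) -> (forall k, k < m -> 0 < f k <= m) ->
  forall k, k < m -> f k = k.+1.
Proof.
move=> f_incr f_bnd k lt_km; apply/eqP; rewrite eqn_leq; apply/andP; split.
  have bound d : k + d < m -> f k + d <= f (k + d).
    elim: d => [|d IHd]; first by rewrite !addn0.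
    by rewrite !addnS => lt_m; apply: leq_ltn_trans (f_incr _ lt_m); apply/IHd/ltnW.
  have := bound (m.-1 - k); rewrite subnKC; last by lia.
  by have := f_bnd m.-1; lia.
elim: k lt_km => [|k IHk] lt_km; first by case/andP: (f_bnd 0 lt_km).
by apply: leq_ltn_trans (f_incr _ lt_km); apply/IHk/ltnW.
Qed.

Lemma ascending_excv m (X : nat -> 'S_m.+1) :
    gallery X -> (forall k, k.+1 < m -> label X k < label X k.+1) ->
  forall k, k <= m -> excv (X k) = [set i : 'I_m.+1 | 0 < i <= k].
Proof.
move=> galX incX k; have labE := @increasing_eqS (label X) m incX.
elim: k => [|k IHk] lt_km.
  have [-> _ _] := galX; rewrite excv1; apply/setP=> i; rewrite !inE; lia.
have [_ _ ->] := gallery_step galX lt_km; rewrite (IHk (ltnW lt_km)).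
apply/setP=> i; rewrite !inE -val_eqE /= labE //; first by lia.
by move=> l lt_lm; rewrite label_gt0 //= -ltnS.
Qed.

Lemma descending_excv m (X : nat -> 'S_m.+1) :
    gallery X -> (forall k, k.+1 < m -> label X k.+1 < label X k) ->
  forall k, k <= m -> excv (X k) = [set i : 'I_m.+1 | m - k < i].
Proof.
move=> galX decX k.
have labE l : l < m -> label X l = m - l :> nat.
  move=> lt_lm; have := @increasing_eqS (fun l => label X (m.-1 - l)) m _ _ (m.-1 - l).
  rewrite subKn; last by lia.
  move->; [lia | | | lia].
    move=> j lt_jm; have := @decX (m.-1 - j.+1).
    by rewrite subnSK; [apply; lia | lia].
  move=> j lt_jm; have := ltn_ord (label X (m.-1 - j)).
  by rewrite label_gt0 //; lia.
elim: k => [|k IHk] lt_km.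
  by have [-> _ _] := galX; rewrite excv1; apply/setP=> i; rewrite !inE; have := ltn_ord i; lia.
have [_ _ ->] := gallery_step galX lt_km; rewrite (IHk (ltnW lt_km)).
by apply/setP=> i; rewrite !inE -val_eqE /= labE //; lia.
Qed.

(** With labels 1, 2, .., m, the preimage of the label i is fixed for good by the
    step that introduces it; it is its preimage under the long cycle, whence
    each step is forced. *)
Lemma ascending_unique m (X Y : nat -> 'S_m.+1) : gallery X -> gallery Y ->
    (forall k, k.+1 < m -> label X k < label X k.+1) ->
    (forall k, k.+1 < m -> label Y k < label Y k.+1) ->
  forall k, k <= m -> X k = Y k.
Proof.
move=> galX galY incX incY.
have stepE Z k : gallery Z -> (forall k, k.+1 < m -> label Z k < label Z k.+1) ->
    k < m -> let i := inord k.+1 in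
    Z k.+1 = (tperm ((long_cycle m.+1)^-1%g i) ((Z k)^-1%g i) * Z k)%g.
  move=> galZ incZ lt_km i.
  have vi : i = k.+1 :> nat by rewrite inordK.
  have ZE := ascending_excv galZ incZ.
  have labi l : l < m -> label Z l = l.+1 :> nat.
    move=> lt_lm; have [_ + ZlE] := gallery_step galZ lt_lm.
    have := setU11 (label Z l) (excv (Z l)).
    by rewrite -ZlE !ZE ?(ltnW lt_lm) // !inE; lia.
  have li : label Z k = i by apply: val_inj; rewrite /= labi // vi.
  have := gallery_step galZ lt_km; rewrite li => /excv_step_tperm[_ _ {1}->].
  have keep d : k.+1 + d <= m -> (Z (k.+1 + d))^-1%g i = (Z k.+1)^-1%g i.
    elim: d => [|d IHd]; first by rewrite addn0.
    rewrite addnS => lt_m; rewrite -(IHd (ltnW lt_m)).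
    apply: (excv_step_keep (gallery_step galZ lt_m)).
      by rewrite (ZE _ (ltnW lt_m)) inE vi; lia.
    by rewrite labi // vi; lia.
  by have := keep (m - k.+1); rewrite subnKC // => <- //; case: galZ => _ ->.
elim=> [|k IHk] lt_km; first by case: galX galY => -> _ _ [-> _ _].
by rewrite (stepE X) // (stepE Y) // IHk // ltnW.
Qed.

(** * The chain of adjacent transpositions *)

Definition e_word m : seq 'S_m.+1 := [seq @simple_transp m.+1 j | j <- enum 'I_m].

Definition e_gallery m k : 'S_m.+1 := foldl (@pmul m.+1) 1%g (take k (e_word m)).

Lemma size_e_word m : size (e_word m) = m.
Proof. by rewrite size_map size_enum_ord. Qed.

Lemma e_galleryS m k (lt_km : k < m) :
  e_gallery m k.+1 = (@simple_transp m.+1 (Ordinal lt_km) * e_gallery m k)%g.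
Proof.
rewrite /e_gallery (take_nth 1%g) ?size_e_word // foldl_rcons /pmul.
congr (_ * _)%g; rewrite (nth_map (Ordinal lt_km)) ?size_enum_ord //.
by congr simple_transp; apply: val_inj; rewrite /= nth_enum_ord.
Qed.

Lemma simple_transpE m (j : 'I_m.-1) (i : 'I_m) :
  @simple_transp m j i =
    (if i == j :> nat then j.+1 else if i == j.+1 :> nat then j : nat else i) :> nat.
Proof.
have lt_j : j.+1 < m by have := ltn_ord j; lia.
rewrite /simple_transp; case: tpermP => [->|->|/eqP + /eqP].
- by rewrite /= eqxx modn_small.
- by rewrite /= modn_small // eqxx gtn_eqF.
- by rewrite -!val_eqE /= modn_small // => /negPf-> /negPf->.
Qed.

(** The k-th partial product is the cycle (0, 1, .., k). *)
Lemma e_galleryE m k (i : 'I_m.+1) : k <= m ->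
  e_gallery m k i = (if i < k then i.+1 else if i == k :> nat then 0 else i) :> nat.
Proof.
elim: k i => [|k IHk] i lt_km.
  by rewrite /e_gallery take0 perm1; case: eqP.
rewrite e_galleryS permM (IHk _ (ltnW lt_km)) simple_transpE /=.
by repeat case: ifP; lia.
Qed.

Lemma e_gallery_gallery m : gallery (e_gallery m).
Proof.
split=> [||k lt_km]; first by rewrite /e_gallery take0.
  apply/permP=> i; apply: val_inj; rewrite /= e_galleryE // permE /=.
  have := ltn_ord i; rewrite ltnS leq_eqVlt => /orP[/eqP->|lt_im].
    by rewrite ltnn eqxx modnn.
  by rewrite lt_im modn_small.
by rewrite (e_galleryS lt_km); eexists; eexists; reflexivity.
Qed.

Lemma e_gallery_excv m k : k <= m -> excv (e_gallery m k) = [set i : 'I_m.+1 | 0 < i <= k].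
Proof.
move=> le_km; apply/setP=> i; rewrite !inE.
have [->|i0] := eqVneq i ord0; first by rewrite ltn0.
have i_gt0 : 0 < i by rewrite lt0n.
rewrite i_gt0 /=; have [lt_ki|le_ik] := ltnP k i.
  rewrite (_ : (e_gallery m k)^-1%g i = i) ?ltnn //; apply: (canLR (permK _)); apply: val_inj.
  by rewrite /= e_galleryE //; repeat case: ifP; lia.
have vi : (inord i.-1 : 'I_m.+1) = i.-1 :> nat by rewrite inordK //; lia.
rewrite (_ : (e_gallery m k)^-1%g i = inord i.-1) ?vi; first by lia.
apply: (canLR (permK _)); apply: val_inj.
by rewrite /= e_galleryE // vi; repeat case: ifP; lia.
Qed.

Lemma e_ascending m k : k.+1 < m -> label (e_gallery m) k < label (e_gallery m) k.+1.
Proof.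
have labE l : l < m -> label (e_gallery m) l = l.+1 :> nat.
  move=> lt_lm; have [_ + XE] := gallery_step (e_gallery_gallery m) lt_lm.
  have := setU11 (label (e_gallery m) l) (excv (e_gallery m l)).
  by rewrite -XE !e_gallery_excv ?(ltnW lt_lm) // !inE; lia.
by move=> lt_km; rewrite !labE // ltnW.
Qed.

Lemma e_chainE m : e_chain m.+1 = chain_of (e_gallery m).
Proof.
apply/setP=> x; rewrite inE.
have -> : 1%g :: scanl (@pmul m.+1) 1%g (e_word m) =
    [seq e_gallery m k | k <- iota 0 m.+1].
  apply: (@eq_from_nth _ 1%g) => [|k].
    by rewrite /= size_scanl size_e_word size_map size_iota.
  rewrite [size _]/= size_scanl size_e_word => lt_km.
  rewrite (nth_map 0) ?size_iota // nth_iota // add0n.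
  case: k lt_km => [|k]; first by rewrite /e_gallery take0.
  by rewrite ltnS => lt_km; rewrite /= nth_scanl ?size_e_word.
apply/mapP/imsetP => [[k]|[k _ ->]].
  by rewrite mem_iota => lt_km ->; exists (Ordinal lt_km).
by exists (k : nat) => //; rewrite mem_iota ltn_ord.
Qed.

(** * Maximal chains and galleries *)

Lemma ell_long_cycle m : ell_T (long_cycle m.+1) = m.
Proof.
by have [_ <- _] := e_gallery_gallery m; apply/gallery_ell/leqnn/e_gallery_gallery.
Qed.

Lemma ell_NC m (x : 'S_m.+1) : x \in NC m.+1 -> ell_T x <= m.
Proof. by rewrite inE => /abs_le_leq; rewrite ell_long_cycle. Qed.

Lemma gallery_abs_le m (X : nat -> 'S_m.+1) k l :
  gallery X -> k <= l -> l <= m -> abs_le (X k) (X l).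
Proof.
move=> galX; elim: l => [|l IHl].
  by rewrite leqn0 => /eqP-> _; apply: abs_le_refl.
rewrite leq_eqVlt ltnS => /orP[/eqP->|le_kl] lt_lm; first exact: abs_le_refl.
apply: (abs_le_trans (IHl le_kl (ltnW lt_lm))).
rewrite abs_leE !(gallery_ell galX) ?(ltnW lt_lm) //.
have [_ _ /(_ l lt_lm)[a [b ->]]] := galX.
by rewrite mulgK -(addn1 l) leq_add2l ell_tperm.
Qed.

Lemma gallery_is_chain m (X : nat -> 'S_m.+1) : gallery X -> is_chain (chain_of X).
Proof.
move=> galX; apply/andP; split.
  apply/subsetP=> _ /imsetP[k _ ->]; rewrite inE.
  by have [_ <- _] := galX; apply: gallery_abs_le => //; rewrite -ltnS.
apply/forall_inP=> _ /imsetP[k _ ->]; apply/forall_inP=> _ /imsetP[l _ ->].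
apply/orP; case/orP: (leq_total k l) => le_kl; [left | right].
  by apply: gallery_abs_le => //; rewrite -ltnS.
by apply: gallery_abs_le => //; rewrite -ltnS.
Qed.

Lemma chain_eq m (C : {set 'S_m.+1}) x y :
  is_chain C -> x \in C -> y \in C -> ell_T x = ell_T y -> x = y.
Proof.
case/andP=> _ /forall_inP chC xC yC xy.
have /forall_inP/(_ y yC)/orP[] := chC x xC => /abs_le_eq; rewrite xy.
  by apply.
by move=> ->.
Qed.

Lemma mem_chain_of m (X : nat -> 'S_m.+1) k : k <= m -> X k \in chain_of X.
Proof. by rewrite -ltnS => lt_km; apply/imsetP; exists (Ordinal lt_km). Qed.

Lemma chain_of_max m (X : nat -> 'S_m.+1) :
  gallery X -> chain_of X \in max_chains m.+1.
Proof.
move=> galX; rewrite inE; apply/maxsetP; split=> [|C chC sXC].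
  exact: gallery_is_chain.
apply/eqP; rewrite eqEsubset sXC andbT; apply/subsetP=> x xC.
have le_xm : ell_T x <= m by case/andP: chC => /subsetP/(_ x xC)/ell_NC.
rewrite (chain_eq chC xC (subsetP sXC _ (mem_chain_of X le_xm))).
  exact: mem_chain_of.
by rewrite gallery_ell.
Qed.

Definition rank_elt m (C : {set 'S_m.+1}) k : 'S_m.+1 :=
  odflt 1%g [pick x in C | ell_T x == k].

Lemma rank_elt_eq m (C : {set 'S_m.+1}) x :
  is_chain C -> x \in C -> rank_elt C (ell_T x) = x.
Proof.
move=> chC xC; rewrite /rank_elt; case: pickP => [y /andP[yC /eqP yx]|/(_ x)] /=.
  exact: chain_eq chC yC xC yx.
by rewrite xC eqxx.
Qed.

Lemma rank_elt_chain_of m (X : nat -> 'S_m.+1) k :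
  gallery X -> k <= m -> rank_elt (chain_of X) k = X k.
Proof.
move=> galX le_km; rewrite -{1}(gallery_ell galX le_km) rank_elt_eq //.
  exact: gallery_is_chain.
exact: mem_chain_of.
Qed.

(** Maximality, in the form of a test for membership. *)
Lemma max_chain_mem m (C : {set 'S_m.+1}) z : C \in max_chains m.+1 ->
  z \in NC m.+1 -> (forall w, w \in C -> abs_le w z || abs_le z w) -> z \in C.
Proof.
rewrite inE => /maxsetP[/andP[sC /forall_inP chC] maxC] zN Cz.
rewrite -(maxC (z |: C)) ?setU11 ?subsetUr //; apply/andP; split.
  by rewrite subUset sub1set zN sC.
apply/forall_inP=> x /setU1P[->|xC]; apply/forall_inP=> y /setU1P[->|yC].
- by rewrite abs_le_refl.
- by rewrite orbC Cz.
- exact: Cz.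
- by move/forall_inP: (chC x xC); apply.
Qed.

(** If the rank k were skipped, an element covering the highest element x of C
    below rank k and lying below the lowest element y above rank k would be
    comparable to the whole chain. *)
Lemma max_chain_rank m (C : {set 'S_m.+1}) k : C \in max_chains m.+1 ->
  k <= m -> exists2 x, x \in C & ell_T x = k.
Proof.
move=> maxC le_km; have NC_C x : x \in C -> abs_le x (long_cycle m.+1).
  move: maxC; rewrite inE => /maxsetP[/andP[/subsetP sC _] _] /sC.
  by rewrite inE.
have chC : is_chain C by move: maxC; rewrite inE => /maxsetP[].
have cmp x y : x \in C -> y \in C -> abs_le x y || abs_le y x.
  by move=> xC yC; case/andP: chC => _ /forall_inP/(_ x xC)/forall_inP/(_ y yC).
have C1 : 1%g \in C.
  apply: max_chain_mem => // [|w _]; first by rewrite inE abs_le1.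
  by rewrite abs_le1 orbT.
have Cc : long_cycle m.+1 \in C.
  apply: max_chain_mem => // [|w /NC_C->//].
  by rewrite inE abs_le_refl.
pose below x := (x \in C) && (ell_T x <= k).
pose above x := (x \in C) && (k <= ell_T x).
have below1 : below 1%g by rewrite /below C1 ell1.
have abovec : above (long_cycle m.+1) by rewrite /above Cc ell_long_cycle.
case: (arg_maxnP (@ell_T m.+1) below1) => x /andP[xC le_xk] maxx.
case: (arg_minnP (@ell_T m.+1) abovec) => y /andP[yC le_ky] miny.
case: (ltngtP (ell_T x) k) le_xk => // [lt_xk _|<-]; last by exists x.
case: (ltngtP (ell_T y) k) le_ky => // [lt_ky _|<-]; last by exists y.
have lt_xy := ltn_trans lt_xk lt_ky.
have xy : abs_le x y.
  by case/orP: (cmp x y xC yC) => // /abs_le_leq; rewrite leqNgt lt_xy.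
have [z [xz zy ez]] := abs_le_cover xy lt_xy.
suff zC : z \in C.
  by have := maxx z; rewrite /below zC ez /= => /(_ lt_xk); rewrite /= ltnn.
apply: max_chain_mem => // [|w wC].
  by rewrite inE (abs_le_trans zy) ?NC_C.
have [le_wk|lt_kw] := leqP (ell_T w) k.
  have le_wx : ell_T w <= ell_T x by apply: maxx; rewrite /below wC.
  have wx : abs_le w x.
    case/orP: (cmp w x wC xC) => // xw.
    by rewrite (abs_le_eq xw le_wx) abs_le_refl.
  by rewrite (abs_le_trans wx xz).
have le_yw : ell_T y <= ell_T w by apply: miny; rewrite /above wC ltnW.
have yw : abs_le y w.
  case/orP: (cmp y w yC wC) => // wy.
  by rewrite (abs_le_eq wy le_yw) abs_le_refl.
by rewrite (abs_le_trans zy yw) orbT.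
Qed.

Lemma max_chain_gallery m (C : {set 'S_m.+1}) : C \in max_chains m.+1 ->
  gallery (rank_elt C) /\ chain_of (rank_elt C) = C.
Proof.
move=> maxC; have chC : is_chain C by move: maxC; rewrite inE => /maxsetP[].
have [sC /forall_inP cmp] := andP chC.
have rankP k : k <= m -> rank_elt C k \in C /\ ell_T (rank_elt C k) = k.
  by move=> /(max_chain_rank maxC)[x xC <-]; rewrite rank_elt_eq.
split; last first.
  apply/setP=> x; apply/imsetP/idP => [[k _ ->]|xC].
    by case: (rankP k); rewrite // -ltnS.
  have lt_xm : ell_T x < m.+1 by rewrite ltnS ell_NC ?(subsetP sC).
  by exists (Ordinal lt_xm); rewrite //= rank_elt_eq.
split=> [||k lt_km].
- by apply: ell_eq0; case: (rankP 0).
- have [mC em] := rankP m (leqnn m); apply: abs_le_eq.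
    by have := subsetP sC _ mC; rewrite inE.
  by rewrite ell_long_cycle em.
have [kC ek] := rankP k (ltnW lt_km); have [k1C ek1] := rankP k.+1 lt_km.
have /forall_inP/(_ _ k1C)/orP[le_k|/abs_le_leq] := cmp _ kC; last first.
  by rewrite ek ek1 ltnn.
have [|a [b ab]] := @ell_eq1 _ (rank_elt C k.+1 * (rank_elt C k)^-1)%g.
  by rewrite abs_le_ell // ek ek1 subSnn.
by exists a, b; rewrite -ab mulgKV.
Qed.

(** * Adjacent chains and inversions *)

Definition agree_off m (k : nat) (X Y : nat -> 'S_m.+1) : Prop :=
  forall l, l <= m -> l != k -> X l = Y l.

Lemma eq_chain_of m (X Y : nat -> 'S_m.+1) :
  (forall k, k <= m -> X k = Y k) -> chain_of X = chain_of Y.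
Proof. by move=> XY; apply: eq_imset => k; rewrite XY // -ltnS. Qed.

Lemma chain_of_rank m (X : nat -> 'S_m.+1) x :
  gallery X -> x \in chain_of X -> x = X (ell_T x).
Proof.
by move=> galX /imsetP[k _ ->]; rewrite gallery_ell // -ltnS.
Qed.

Lemma mem_chain_of_eq m (X Y : nat -> 'S_m.+1) k : gallery X -> gallery Y ->
  k <= m -> (X k \in chain_of Y) = (X k == Y k).
Proof.
move=> galX galY le_km; apply/idP/eqP=> [/(chain_of_rank galY)|->].
  by rewrite gallery_ell.
exact: mem_chain_of.
Qed.

Lemma gallery_inj m (X : nat -> 'S_m.+1) k l : gallery X -> k <= m -> l <= m ->
  X k = X l -> k = l.
Proof.
by move=> galX le_k le_l eq_kl; rewrite -(gallery_ell galX le_k) eq_kl gallery_ell.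
Qed.

Lemma chain_of_diff m (X Y : nat -> 'S_m.+1) k : gallery X -> gallery Y ->
  k <= m -> X k != Y k -> agree_off k X Y -> #|chain_of X :\: chain_of Y| == 1.
Proof.
move=> galX galY le_km XYk XY; apply/cards1P; exists (X k).
apply/setP=> x; rewrite !inE; apply/andP/eqP=> [[xY xX]|->]; last first.
  by rewrite mem_chain_of_eq // XYk mem_chain_of.
have /imsetP[l _ x_l] := xX; have le_lm : l <= m by rewrite -ltnS.
rewrite x_l; congr X; apply/eqP; move: xY; rewrite x_l mem_chain_of_eq //.
by apply: contraNT => lk; rewrite XY.
Qed.

Lemma adj_chain_of m (X Y : nat -> 'S_m.+1) : gallery X -> gallery Y ->
  hurwitz_adj (chain_of X) (chain_of Y) <->
  exists k, [/\ k.+1 < m, X k.+1 != Y k.+1 & agree_off k.+1 X Y].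
Proof.
move=> galX galY; split=> [/and4P[_ _ /cards1P[x xE] _]|[k [lt_km XYk XY]]].
  have : x \in chain_of X :\: chain_of Y by rewrite xE set11.
  case/setDP=> /imsetP[k _ x_k].
  have le_km : k <= m by rewrite -ltnS.
  rewrite x_k mem_chain_of_eq // => XYk.
  have XY : agree_off k X Y.
    move=> l le_lm lk; apply/eqP; rewrite -mem_chain_of_eq //.
    apply: contraNT lk => lY; have : X l \in chain_of X :\: chain_of Y.
      by rewrite inE lY mem_chain_of.
    by rewrite xE x_k => /set1P/(gallery_inj galX le_lm le_km)->.
  have k_m : k != m :> nat.
    by apply: contraNneq XYk => ->; case: galX galY => _ -> _ [_ -> _].
  case: (k : nat) k_m XYk XY le_km => [|l] lm XYk XY le_lm.
    by case: galX galY XYk => -> _ _ [-> _ _]; rewrite eqxx.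
  by exists l; rewrite ltn_neqAle lm.
have le_km := ltnW lt_km; apply/and4P; split; rewrite ?chain_of_max //.
  exact: (chain_of_diff galX galY le_km).
apply: (chain_of_diff galY galX le_km); first by rewrite eq_sym.
by move=> l le_lm lk; rewrite XY.
Qed.

(** For a maximal chain these are the inversions of its sequence of labels.  As 0
    is never a label, every pair (0, j) would be counted without 0 < i. *)
Definition chain_inv m (C : {set 'S_m.+1}) : {set 'I_m.+1 * 'I_m.+1} :=
  [set ij : 'I_m.+1 * 'I_m.+1 | [&& 0 < ij.1, ij.1 < ij.2 &
     [exists x in C, (ij.2 \in excv x) && (ij.1 \notin excv x)]]].

Lemma chain_invP m (X : nat -> 'S_m.+1) (i j : 'I_m.+1) :
  reflect [/\ 0 < i, i < j
            & exists k, [/\ k <= m, j \in excv (X k) & i \notin excv (X k)]]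
          ((i, j) \in chain_inv (chain_of X)).
Proof.
rewrite inE /=; apply: (iffP and3P) => -[i0 ij b]; split=> //.
  case/existsP: b => x /and3P[/imsetP[k _ ->] jX iX].
  by exists k; split; rewrite // -ltnS.
case: b => k [le_km jX iX]; apply/existsP; exists (X k).
by rewrite mem_chain_of // jX.
Qed.

Lemma chain_inv_e m : chain_inv (e_chain m.+1) = set0.
Proof.
apply/setP=> -[i j]; rewrite [RHS]inE e_chainE; apply/chain_invP=> -[i0 ij [k []]].
by move=> le_km; rewrite e_gallery_excv // !inE; lia.
Qed.

Lemma chain_inv_sub m (X Y : nat -> 'S_m.+1) :
    (forall k, k <= m -> excv (X k) = excv (Y k)) ->
  chain_inv (chain_of X) \subset chain_inv (chain_of Y).
Proof.
move=> XY; apply/subsetP=> -[i j] /chain_invP[i0 ij [k [le_km jX iX]]].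
by apply/chain_invP; split=> //; exists k; rewrite -XY.
Qed.

Lemma label_neq m (X : nat -> 'S_m.+1) k : gallery X -> k.+1 < m ->
  label X k != label X k.+1.
Proof.
move=> galX lt_km; have [_ _ XkE] := gallery_step galX (ltnW lt_km).
have [_ + _] := gallery_step galX lt_km; apply: contraNneq => <-.
by rewrite XkE setU11.
Qed.

(** Both pairs of labels around rank k.+1 fill the same difference of excedance
    sets. *)
Lemma agree_label m (X Y : nat -> 'S_m.+1) k : gallery X -> gallery Y ->
    k.+1 < m -> agree_off k.+1 X Y ->
  label Y k = label X k \/
  label Y k = label X k.+1 /\ label Y k.+1 = label X k.
Proof.
move=> galX galY lt_km XY; have neqY := label_neq galY lt_km.
have [_ xk XkE] := gallery_step galX (ltnW lt_km).
have [_ yk YkE] := gallery_step galY (ltnW lt_km).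
have [_ xk1 XkE1] := gallery_step galX lt_km.
have [_ yk1 YkE1] := gallery_step galY lt_km.
have XY0 : X k = Y k by apply: XY; rewrite ?neq_ltn ?ltnSn // ltnW // ltnW.
have XY2 : X k.+2 = Y k.+2 by apply: XY; rewrite ?neq_ltn ?ltnSn ?orbT.
move: YkE1; rewrite YkE -XY2 -XY0 XkE1 XkE => YE.
have := setU11 (label Y k) (label Y k.+1 |: excv (X k)); rewrite setUCA -YE.
rewrite -XY0 in yk.
rewrite !inE in yk *; rewrite (negPf yk) orbF.
case/orP=> /eqP yk_eq; [right; split=> // | by left].
have := setU11 (label X k) (excv (X k)).
have := setU11 (label X k) (label X k.+1 |: excv (X k)); rewrite setUCA YE.
rewrite !inE in xk *; rewrite (negPf xk) orbF => /orP[/eqP-> //|].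
by rewrite yk_eq (negPf (label_neq galX lt_km)).
Qed.

(** The order in which two labels appear is only altered for the pair of labels
    around rank k.+1: for any other pair (p, q) that is separated by the element
    of rank k.+1, one of the two neighbouring ranks separates it too. *)
Lemma chain_inv_swap m (X Y : nat -> 'S_m.+1) k : gallery X -> gallery Y ->
    k.+1 < m -> agree_off k.+1 X Y -> label X k < label X k.+1 ->
    label Y k = label X k.+1 ->
  #|chain_inv (chain_of Y)| = #|chain_inv (chain_of X)|.+1.
Proof.
move=> galX galY lt_km XY lt_ij Yk.
have lt_km' := ltnW lt_km.
have [_ xk XkE] := gallery_step galX (ltnW lt_km).
have [_ yk YkE] := gallery_step galY (ltnW lt_km).
have [_ xk1 XkE1] := gallery_step galX lt_km.
have [_ yk1 YkE1] := gallery_step galY lt_km.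
have XY0 : X k = Y k by apply: XY; rewrite ?neq_ltn ?ltnSn // ltnW.
have XY2 : X k.+2 = Y k.+2 by apply: XY; rewrite ?neq_ltn ?ltnSn ?orbT.
rewrite XkE in xk1 XkE1.
move: xk xk1 XkE XkE1 YkE lt_ij; rewrite Yk -XY0.
have i_gt0 := label_gt0 galX lt_km'.
set i := label X k in i_gt0 *; set j := label X k.+1; set E := excv (X k).
rewrite in_setU1 negb_or => iE /andP[ji jE] XkE XkE1 YkE lt_ij.
suff -> : chain_inv (chain_of Y) = (i, j) |: chain_inv (chain_of X).
  rewrite cardsU1; case: chain_invP => // -[_ _ [l [le_lm jX iX]]].
  have [le_lk|lt_kl] := leqP l k.
    by rewrite (subsetP (gallery_excv_sub galX le_lk _)) // ltnW in jE.
  case/negP: iX; apply: (subsetP (gallery_excv_sub galX lt_kl le_lm)).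
  by rewrite XkE setU11.
apply/setP=> -[p q]; rewrite in_setU1.
apply/chain_invP/predU1P => [[p0 pq [l [le_lm qY pY]]]|[[-> ->]|/chain_invP]].
- have [l_k|l_k] := eqVneq l k.+1; last first.
    by right; apply/chain_invP; split=> //; exists l; rewrite XY.
  move: pY qY; rewrite l_k YkE !in_setU1 negb_or => /andP[pj pE].
  have [q_j _|/= qj qE] := eqVneq q j; last first.
    right; apply/chain_invP; split=> //; exists k; split=> //.
    by rewrite ltnW // ltnW.
  have [->|pi] := eqVneq p i; [by left; rewrite q_j | right].
  apply/chain_invP; split=> //; exists k.+2; rewrite XkE1 !in_setU1 q_j eqxx.
  by rewrite !negb_or pi pj.
- split=> //; exists k.+1; split; rewrite ?(ltnW lt_km) // YkE ?setU11 //.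
  by rewrite in_setU1 negb_or iE andbT neq_ltn lt_ij.
case=> p0 pq [l [le_lm qX pX]]; split=> //.
have [l_k|l_k] := eqVneq l k.+1; last by exists l; rewrite -XY.
move: pX qX; rewrite l_k XkE !in_setU1 negb_or => /andP[pi pE].
have [q_i _|/= qi qE] := eqVneq q i; last first.
  by exists k; rewrite -XY0 (ltnW lt_km').
exists k.+2; rewrite -XY2 XkE1 !in_setU1 q_i eqxx orbT; split=> //.
by rewrite !negb_or pi pE !andbT neq_ltn (ltn_trans pq) // q_i.
Qed.

Lemma adj_chain_inv m (X Y : nat -> 'S_m.+1) : gallery X -> gallery Y ->
    hurwitz_adj (chain_of X) (chain_of Y) ->
  #|chain_inv (chain_of Y)| <= #|chain_inv (chain_of X)| \/
  #|chain_inv (chain_of Y)| = #|chain_inv (chain_of X)|.+1 /\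
  exists k, [/\ k.+1 < m, agree_off k.+1 X Y,
    label X k < label X k.+1, label Y k = label X k.+1
    & label Y k.+1 = label X k].
Proof.
move=> galX galY /(adj_chain_of galX galY)[k [lt_km _ XY]].
have lt_km' := ltnW lt_km.
have [Yk|[Yk Yk1]] := agree_label galX galY lt_km XY.
  left; apply/subset_leq_card/chain_inv_sub => l le_lm.
  have [->|l_k] := eqVneq l k.+1; last by rewrite XY.
  have [_ _ ->] := gallery_step galX lt_km'.
  have [_ _ ->] := gallery_step galY lt_km'.
  by rewrite Yk XY // ?neq_ltn ?ltnSn // ltnW.
have [lt_lab|] := ltnP (label X k) (label X k.+1).
  by right; split; [apply: (chain_inv_swap galX galY lt_km) | exists k].
rewrite leq_eqVlt => /orP[/eqP/val_inj eq_lab|lt_lab].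
  by have := label_neq galX lt_km; rewrite eq_lab eqxx.
left; rewrite (@chain_inv_swap _ Y X k) ?Yk ?Yk1 //.
by move=> l le_lm l_k; rewrite XY.
Qed.

Lemma gallery_exchange m (X : nat -> 'S_m.+1) k : gallery X -> k.+1 < m ->
  exists Y, [/\ gallery Y, agree_off k.+1 X Y, label Y k = label X k.+1
    & label Y k.+1 = label X k].
Proof.
move=> galX lt_km; have lt_km' := ltnW lt_km.
have Xk := gallery_step galX lt_km'; have Xk1 := gallery_step galX lt_km.
have [z [xz zy]] : exists z, excv_step (X k) (label X k.+1) z /\
    excv_step z (label X k) (X k.+2).
  case: (ltngtP (label X k) (label X k.+1)) (label_neq galX lt_km).
  - by move=> lt_lab _; apply: ascent_exchange Xk Xk1.
  - by move=> lt_lab _; apply: descent_exchange Xk Xk1.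
  - by move/val_inj->; rewrite eqxx.
pose Y l := if l == k.+1 then z else X l.
have Yk : Y k = X k by rewrite /Y ltn_eqF.
have Yk1 : Y k.+1 = z by rewrite /Y eqxx.
have Yk2 : Y k.+2 = X k.+2 by rewrite /Y gtn_eqF.
exists Y; split.
- case: galX => X0 Xm XS; split=> [//||l lt_lm]; rewrite /Y; first by rewrite gtn_eqF.
  rewrite eqSS; have [->|l_k] := eqVneq l k.
    by rewrite ltn_eqF //; case: xz.
  have [->|//] := eqVneq l k.+1; first by case: zy.
  by move=> _; apply: XS.
- by move=> l _ /negPf l_k; rewrite /Y l_k.
- by apply: label_eq; rewrite Yk Yk1.
- by apply: label_eq; rewrite Yk2 Yk1.
Qed.

(** * Distance from e *)

Lemma exchange_adj m (X Y : nat -> 'S_m.+1) k : gallery X -> gallery Y ->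
    k.+1 < m -> agree_off k.+1 X Y -> label Y k = label X k.+1 ->
  hurwitz_adj (chain_of X) (chain_of Y).
Proof.
move=> galX galY lt_km XY Yk; apply/(adj_chain_of galX galY); exists k; split=> //.
have lt_km' := ltnW lt_km.
have XYk : X k = Y k by apply: XY; rewrite ?neq_ltn ?ltnSn // ltnW.
apply: contraNneq (label_neq galX lt_km) => eqXY; rewrite -Yk; apply/eqP/esym.
by apply: label_eq; rewrite -eqXY -XYk; apply: gallery_step.
Qed.

Definition weak_coverF m (C D : {set 'S_m.+1}) : bool :=
  hurwitz_adj C D && (#|chain_inv D| == #|chain_inv C|.+1).

Lemma exchange_cover m (X Y : nat -> 'S_m.+1) k : gallery X -> gallery Y ->
    k.+1 < m -> agree_off k.+1 X Y -> label X k < label X k.+1 ->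
    label Y k = label X k.+1 -> weak_coverF (chain_of X) (chain_of Y).
Proof.
move=> galX galY lt_km XY lt_lab Yk; rewrite /weak_coverF.
by rewrite (exchange_adj galX galY lt_km) // (chain_inv_swap galX galY lt_km) ?eqxx.
Qed.

Lemma chain_of_ascending m (X : nat -> 'S_m.+1) : gallery X ->
    (forall k, k.+1 < m -> label X k < label X k.+1) ->
  chain_of X = e_chain m.+1.
Proof.
move=> galX incX; rewrite e_chainE; apply: eq_chain_of.
by apply: ascending_unique => //; [apply: e_gallery_gallery | apply: e_ascending].
Qed.

Lemma e_chain_max m : e_chain m.+1 \in max_chains m.+1.
Proof. by rewrite e_chainE chain_of_max //; apply: e_gallery_gallery. Qed.

(** Exchanging the two labels at a descent removes one inversion. *)
Lemma not_e_cover m (C : {set 'S_m.+1}) : C \in max_chains m.+1 ->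
  C != e_chain m.+1 -> exists2 D, D \in max_chains m.+1 & weak_coverF D C.
Proof.
move=> /max_chain_gallery[]; move: (rank_elt C) => X galX <- {C} Xe.
have [/existsP[k /andP[lt_km lt_lab]]|/existsPn noD] :=
    boolP [exists k : 'I_m, (k.+1 < m) && (label X k.+1 < label X k)].
  have [Y [galY XY Yk Yk1]] := gallery_exchange galX lt_km.
  exists (chain_of Y); first exact: chain_of_max.
  apply: (exchange_cover galY galX lt_km); rewrite ?Yk ?Yk1 //.
  by move=> l le_lm l_k; rewrite XY.
case/eqP: Xe; apply: chain_of_ascending => // k lt_km.
have := noD (Ordinal (ltnW lt_km)); rewrite /= lt_km /= -leqNgt leq_eqVlt.
case/orP=> // /eqP/val_inj eq_lab.
by have := label_neq galX lt_km; rewrite eq_lab eqxx.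
Qed.

Lemma adj_inv_le m (C D : {set 'S_m.+1}) : hurwitz_adj C D ->
  #|chain_inv D| <= #|chain_inv C|.+1.
Proof.
move=> adjCD; have /and4P[CM DM _ _] := adjCD; move: adjCD.
have [galX <-] := max_chain_gallery CM; have [galY <-] := max_chain_gallery DM.
by case/(adj_chain_inv galX galY)=> [le_inv|[-> //]]; apply: leqW.
Qed.

Lemma adj_path_inv m (C : {set 'S_m.+1}) p : path (@hurwitz_adj m.+1) C p ->
  #|chain_inv (last C p)| <= #|chain_inv C| + size p.
Proof.
elim: p C => [|D p IHp] C /=; first by rewrite addn0.
case/andP=> /adj_inv_le le_inv /IHp le_p.
by rewrite (leq_trans le_p) // addnS -addSn leq_add2r.
Qed.

Lemma cover_path_adj m (C : {set 'S_m.+1}) p : path (@weak_coverF m) C p ->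
  path (@hurwitz_adj m.+1) C p.
Proof. by apply: sub_path => D D' /andP[]. Qed.

Lemma cover_path_inv m (C : {set 'S_m.+1}) p : path (@weak_coverF m) C p ->
  #|chain_inv (last C p)| = #|chain_inv C| + size p.
Proof.
elim: p C => [|D p IHp] C /=; first by rewrite addn0.
by case/andP=> /andP[_ /eqP eq_inv] /IHp->; rewrite eq_inv addSnnS.
Qed.

(** Each edge gains at most one inversion, so a path whose length equals the total
    gain gains one at each edge. *)
Lemma tight_path_cover m (C : {set 'S_m.+1}) p :
    path (@hurwitz_adj m.+1) C p ->
    #|chain_inv (last C p)| = #|chain_inv C| + size p ->
  path (@weak_coverF m) C p.
Proof.
elim: p C => //= D p IHp C /andP[CD pD] eq_inv.
have := adj_inv_le CD; have := adj_path_inv pD; rewrite eq_inv => le_p le_CD.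
have eqD : #|chain_inv D| = #|chain_inv C|.+1.
  by apply/eqP; rewrite eqn_leq le_CD -(leq_add2r (size p)) addSnnS.
by rewrite /weak_coverF CD eqD eqxx IHp // eqD eq_inv addSnnS.
Qed.

(** As each edge of such a path gains one inversion, the number of inversions
    bounds the distance from e. *)
Lemma e_path m (C : {set 'S_m.+1}) : C \in max_chains m.+1 ->
  exists2 p, path (@weak_coverF m) (e_chain m.+1) p & last (e_chain m.+1) p = C.
Proof.
move: {-1}#|chain_inv C| (eqxx #|chain_inv C|) => r.
elim: r C => [|r IHr] C invC CM.
  have [->|Ce] := eqVneq C (e_chain m.+1); first by exists [::].
  by have [D _ /andP[_]] := not_e_cover CM Ce; rewrite (eqP invC).
have Ce : C != e_chain m.+1.
  by apply: contraTneq invC => ->; rewrite chain_inv_e cards0.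
have [D DM DC] := not_e_cover CM Ce.
have [|p p_path p_last] := IHr D _ DM.
  by case/andP: DC => _; rewrite (eqP invC) eqSS eq_sym.
by exists (rcons p C); rewrite ?last_rcons // rcons_path p_path p_last.
Qed.

Lemma adj_path_max m (C : {set 'S_m.+1}) p : C \in max_chains m.+1 ->
  path (@hurwitz_adj m.+1) C p -> last C p \in max_chains m.+1.
Proof.
case/lastP: p => // p D _; rewrite rcons_path last_rcons.
by case/andP=> _ /and4P[].
Qed.

(** The geodesics from e are the paths that gain an inversion at each edge. *)
Lemma weakF_leE m (u v : {set 'S_m.+1}) : weakF_le u v <->
  u \in max_chains m.+1 /\ connect (@weak_coverF m) u v.
Proof.
set e := e_chain m.+1; have eM : e \in max_chains m.+1 by apply: e_chain_max.
have inv_e : #|chain_inv e| = 0 by rewrite chain_inv_e cards0.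
split=> [[p [p_path p_last p_min] up]|[uM /connectP[p p_path p_last]]].
  have vM : v \in max_chains m.+1 by rewrite -p_last adj_path_max.
  have [q q_path q_last] := e_path vM.
  have := cover_path_inv q_path; rewrite -/e inv_e add0n q_last => inv_v.
  have p_cover : path (@weak_coverF m) e p.
    apply: tight_path_cover => //; apply/eqP; rewrite eqn_leq adj_path_inv //=.
    by rewrite inv_e add0n p_last inv_v p_min // cover_path_adj.
  case/splitPl: up p_cover p_last => p1 p2 p1_last.
  rewrite cat_path last_cat p1_last => /andP[p1_path p2_path] p2_last.
  split; last by apply/connectP; exists p2.
  by rewrite -p1_last adj_path_max // cover_path_adj.
have [q q_path q_last] := e_path uM; exists (q ++ p); last first.
  by rewrite -cat_cons mem_cat -q_last mem_last.
have qp_path : path (@weak_coverF m) e (q ++ p) by rewrite cat_path q_path q_last.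
have qp_last : last e (q ++ p) = v by rewrite last_cat q_last.
split=> // [|r r_path r_last]; first exact: cover_path_adj.
have := adj_path_inv r_path; have := cover_path_inv qp_path.
by rewrite qp_last r_last inv_e !add0n => ->.
Qed.

(** At an ascent an exchange would lead to a larger chain. *)
Lemma maximal_descending m (w : {set 'S_m.+1}) : weakF_maximal w ->
  forall k, k.+1 < m -> label (rank_elt w) k.+1 < label (rank_elt w) k.
Proof.
case=> wM w_max k lt_km; have [galX Xw] := max_chain_gallery wM.
rewrite ltnNge leq_eqVlt; apply/negP=> /orP[/eqP/val_inj eq_lab|lt_lab].
  by have := label_neq galX lt_km; rewrite eq_lab eqxx.
have [Y [galY XY Yk _]] := gallery_exchange galX lt_km.
have := exchange_cover galX galY lt_km XY lt_lab Yk; rewrite Xw => wY.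
have Yw : chain_of Y = w.
  apply: w_max; first exact: chain_of_max.
  by apply/weakF_leE; split=> //; apply: connect1.
by move: wY; rewrite Yw /weak_coverF eqn_leq ltnn !andbF.
Qed.

(** * Forests and the embedding of the Boolean lattice *)

(** If j and p j lie in different cycles of z, this inserts the cycle of j right
    after p j. *)
Definition graft n (p : 'I_n -> 'I_n) (z : 'S_n) (j : 'I_n) : 'S_n :=
  (z * tperm (z (p j)) j)%g.

(** The labels m, m - 1, .., m - k + 1 are treated in this order, largest first,
    so that a vertex is grafted together with its whole subtree. *)
Fixpoint forest m (p : 'I_m.+1 -> 'I_m.+1) (S : {set 'I_m.+1}) k : 'S_m.+1 :=
  if k is l.+1 then
    if inord (m - l) \in S then graft p (forest p S l) (inord (m - l))
    else forest p S l
  else 1%g.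

Lemma mulg_tperm n (z : 'S_n) (a b : 'I_n) :
  (z * tperm a b = tperm (z^-1%g a) (z^-1%g b) * z)%g.
Proof. by rewrite -tpermJ conjgE invgK !mulgA mulgKV. Qed.

Lemma graftE n (p : 'I_n -> 'I_n) (z : 'S_n) (j : 'I_n) :
  graft p z j = (tperm (p j) (z^-1%g j) * z)%g.
Proof. by rewrite /graft mulg_tperm permK. Qed.

(** If the transposition moves p j to b, both grafts differ by (z (p j), j) and
    (z b, j), and the product of these with (z (p j), z b) is a transposition
    again.  Degenerate cases give the identity, as tperm c c. *)
Lemma graft_tperm n (p : 'I_n -> 'I_n) (z : 'S_n) (j a b : 'I_n) :
  exists c d, graft p (tperm a b * z)%g j = (tperm c d * graft p z j)%g.
Proof.
have caseA x y : p j = x ->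
    exists c d, graft p (tperm x y * z)%g j = (tperm c d * graft p z j)%g.
  move=> pj; have [xy|xy] := eqVneq x y.
    by exists x, x; rewrite xy !tperm1 !mul1g.
  rewrite /graft pj permM tpermL.
  have zxy : (tperm x y * z = z * tperm (z x) (z y))%g by rewrite mulg_tperm !permK.
  have [zx|zx] := eqVneq (z x) j.
    exists x, x; rewrite zxy zx tperm1 mul1g tperm1 mulg1.
    by rewrite [tperm (z y) j]tpermC -mulgA tperm2 mulg1.
  exists (z^-1%g (z y)), (z^-1%g j); rewrite [RHS]mulgA -mulg_tperm zxy.
  rewrite -!mulgA; congr (_ * _)%g; rewrite [RHS]tperm_conj.
  by rewrite tpermR tpermD 1?eq_sym // (inj_eq perm_inj).
have [pa|pa] := eqVneq (p j) a; first exact: caseA.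
have [pb|pb] := eqVneq (p j) b; first by rewrite tpermC; apply: caseA.
by exists a, b; rewrite /graft permM tpermD 1?eq_sym // mulgA.
Qed.

Lemma eq_forest m (p : 'I_m.+1 -> 'I_m.+1) (S S' : {set 'I_m.+1}) k : k <= m ->
    (forall i : 'I_m.+1, m - k < i -> (i \in S) = (i \in S')) ->
  forest p S k = forest p S' k.
Proof.
elim: k => //= k IHk lt_km SS'.
have -> : (inord (m - k) \in S) = (inord (m - k) \in S').
  by apply: SS'; rewrite inordK; lia.
by rewrite IHk ?(ltnW lt_km) // => i lt_i; apply: SS'; lia.
Qed.

Lemma forest_stable m (p : 'I_m.+1 -> 'I_m.+1) (S : {set 'I_m.+1}) k l :
    (forall i : 'I_m.+1, i \in S -> m - k < i) -> k <= l -> l <= m ->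
  forest p S l = forest p S k.
Proof.
move=> sS; elim: l => [|l IHl]; first by rewrite leqn0 => /eqP->.
rewrite leq_eqVlt ltnS => /orP[/eqP->//|le_kl] lt_lm /=.
case: ifP => [/sS|_]; first by rewrite inordK; lia.
by rewrite IHl // ltnW.
Qed.

(** The forests agree until j is grafted; later grafts preserve the property of
    differing by a transposition. *)
Lemma forest_setU1 m (p : 'I_m.+1 -> 'I_m.+1) (S : {set 'I_m.+1}) j k : k <= m ->
  exists a b, forest p (j |: S) k = (tperm a b * forest p S k)%g.
Proof.
have triv (z : 'S_m.+1) : z = (tperm ord0 ord0 * z)%g by rewrite tperm1 mul1g.
elim: k => [_|k IHk lt_km]; first by exists ord0, ord0; apply: triv.
have [a [b IH]] := IHk (ltnW lt_km); rewrite /= in_setU1.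
have [jS|jS] := boolP (j \in S).
  exists ord0, ord0; rewrite -triv -in_setU1.
  by have /setUidPr-> : [set j] \subset S by rewrite sub1set.
have [j_k|_] /= := eqVneq (inord (m - k)) j; last first.
  by case: ifP => _; rewrite IH; [apply: graft_tperm | exists a, b].
rewrite j_k (negPf jS) (@eq_forest _ p (j |: S) S k (ltnW lt_km)).
  by rewrite graftE; eexists; eexists; reflexivity.
move=> i; rewrite in_setU1 -j_k; have [->|//] := eqVneq i (inord (m - k)).
by rewrite inordK; lia.
Qed.

(** When j is grafted, it is not yet an excedance value; so its preimage is at
    least j, hence larger than p j, and j is the only value that can be added. *)
Lemma forest_excv m (p : 'I_m.+1 -> 'I_m.+1) (S : {set 'I_m.+1}) k : k <= m ->
    (forall j : 'I_m.+1, 0 < j -> p j < j) ->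
  excv (forest p S k) \subset [set i in S | m - k < i].
Proof.
move=> + p_lt; elim: k => [|k IHk] lt_km; first by rewrite excv1 sub0set.
have vk : (inord (m - k) : 'I_m.+1) = m - k :> nat by rewrite inordK; lia.
have sub : [set i in S | m - k < i] \subset [set i in S | m - k.+1 < i].
  by apply/subsetP=> i; rewrite !inE => /andP[-> /=]; lia.
have {}IHk := IHk (ltnW lt_km).
rewrite /=; case: ifP => [kS|_]; last exact: subset_trans sub.
rewrite graftE; apply: subset_trans (excv_tpermM _ _) _.
  have le_k : (inord (m - k) : 'I_m.+1) <= (forest p S k)^-1%g (inord (m - k)).
    rewrite leqNgt; apply/negP=> lt_k.
    have : inord (m - k) \in excv (forest p S k) by rewrite inE.
    by move/(subsetP IHk); rewrite inE vk ltnn andbF.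
  by apply: leq_trans le_k; apply/ltnW/p_lt; rewrite vk; lia.
rewrite permKV subUset sub1set !inE kS vk (subset_trans IHk sub) andbT.
by lia.
Qed.

(** Adding the missing labels one at a time leads to the long cycle, which has m
    excedance values; hence the forest on S has at least #|S| of them. *)
Lemma forest_excvE m (p : 'I_m.+1 -> 'I_m.+1) (S : {set 'I_m.+1}) :
    (forall j : 'I_m.+1, 0 < j -> p j < j) ->
    forest p [set~ ord0] m = long_cycle m.+1 ->
  ord0 \notin S -> excv (forest p S m) = S.
Proof.
move=> p_lt pc S0; apply/eqP; rewrite eqEcard; apply/andP; split.
  apply: subset_trans (forest_excv S (leqnn m) p_lt) _.
  by apply/subsetP=> i; rewrite inE => /andP[].
move: {-1}#|~: S| (eqxx #|~: S|) => r; elim: r S S0 => [|r IHr] S S0 cS.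
  by move: S0; rewrite -in_setC (cards0_eq (eqP cS)) inE.
have [eqS|[j]] := set_0Vmem ([set~ ord0] :\: S).
  have -> : S = [set~ ord0].
    apply/eqP; rewrite eqEsubset -[X in _ && X]setD_eq0 eqS eqxx andbT.
    by rewrite subsetC sub1set inE.
  by rewrite pc excv_long_cycle.
rewrite !inE => /andP[jS j0]; have [a [b eq_f]] := forest_setU1 p S j (leqnn m).
have := IHr (j |: S); rewrite in_setU1 negb_or eq_sym j0 S0 => /(_ isT).
rewrite eq_f cardsU1 jS => IH; rewrite -ltnS.
apply: leq_trans (IH _) (card_excv_tpermM _ _ _).
have -> : ~: (j |: S) = ~: S :\ j by rewrite setDE setCU setIC.
by move: cS; rewrite (cardsD1 j) inE jS add1n eqSS.
Qed.

(** In a descending gallery, j is introduced by the step from rank m - j to rank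
    m - j + 1. *)
Definition parent m (X : nat -> 'S_m.+1) (j : 'I_m.+1) : 'I_m.+1 :=
  (X (m - j).+1)^-1%g j.

Lemma descending_label m (X : nat -> 'S_m.+1) : gallery X ->
    (forall k, k.+1 < m -> label X k.+1 < label X k) ->
  forall k, k < m -> label X k = inord (m - k).
Proof.
move=> galX decX k lt_km; have XE := descending_excv galX decX.
have [_ + XkE] := gallery_step galX lt_km.
have := setU11 (label X k) (excv (X k)); rewrite -XkE !XE ?(ltnW lt_km) // !inE.
by move=> lt_l le_l; apply: val_inj; rewrite /= inordK; lia.
Qed.

Lemma parent_lt m (X : nat -> 'S_m.+1) : gallery X ->
    (forall k, k.+1 < m -> label X k.+1 < label X k) ->
  forall j : 'I_m.+1, 0 < j -> parent X j < j.
Proof.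
move=> galX decX j j_gt0; have := ltn_ord j => lt_jm.
have : j \in excv (X (m - j).+1).
  by rewrite (descending_excv galX decX) ?inE; lia.
by rewrite inE.
Qed.

(** The forests on the labels m, m - 1, .. are the elements of the gallery, since
    each step is determined by the preimages of its label. *)
Lemma forest_parent m (X : nat -> 'S_m.+1) (S : {set 'I_m.+1}) k : gallery X ->
    (forall k, k.+1 < m -> label X k.+1 < label X k) -> k <= m ->
    (forall i : 'I_m.+1, m - k < i -> i \in S) -> forest (parent X) S k = X k.
Proof.
move=> galX decX; elim: k => [|k IHk] lt_km SP /=; first by case: galX => ->.
have vk : (inord (m - k) : 'I_m.+1) = m - k :> nat by rewrite inordK; lia.
rewrite SP ?vk; last by lia.
rewrite IHk ?(ltnW lt_km) //; last by move=> i lt_i; apply: SP; lia.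
have := gallery_step galX lt_km; rewrite (descending_label galX decX lt_km).
case/excv_step_tperm=> _ _ XkE.
by rewrite graftE /parent vk subKn ?(ltnW lt_km) // -XkE.
Qed.

(** * Chains of forests indexed by permutations *)

(** The labels are the nonzero elements of 'I_m.+1; they are identified with 'I_m
    by lift ord0. *)
Definition prefix_set m (s : 'S_m) k : {set 'I_m.+1} :=
  [set lift ord0 (s i) | i : 'I_m & i < k].

Lemma mem_prefix_set m (s : 'S_m) (i : 'I_m) k : (lift ord0 (s i) \in prefix_set s k) = (i < k).
Proof.
apply/imsetP/idP => [[j]|lt_ik]; last by exists i; rewrite ?inE.
by rewrite inE => lt_jk /lift_inj/perm_inj->.
Qed.

Lemma ord0_prefix_set m (s : 'S_m) k : ord0 \notin prefix_set s k.
Proof. by apply/imsetP=> -[i _ /eqP]; rewrite -val_eqE. Qed.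

Lemma prefix_setS m (s : 'S_m) (i : 'I_m) : prefix_set s i.+1 = lift ord0 (s i) |: prefix_set s i.
Proof.
apply/setP=> j; rewrite in_setU1; case: (unliftP ord0 j) => [l|] ->.
  rewrite -(permKV s l) !mem_prefix_set (inj_eq lift_inj) (inj_eq perm_inj).
  by rewrite ltnS leq_eqVlt.
by rewrite (negPf (ord0_prefix_set _ _)) (negPf (ord0_prefix_set _ _)) orbF.
Qed.

Lemma prefix_set0 m (s : 'S_m) : prefix_set s 0 = set0.
Proof.
apply/setP=> j; rewrite inE; case: (unliftP ord0 j) => [l|] ->.
  by rewrite -(permKV s l) mem_prefix_set.
by rewrite (negPf (ord0_prefix_set _ _)).
Qed.

Lemma prefix_set_full m (s : 'S_m) : prefix_set s m = [set~ ord0].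
Proof.
apply/setP=> j; rewrite !inE; case: (unliftP ord0 j) => [l|] ->.
  by rewrite -(permKV s l) mem_prefix_set ltn_ord.
by rewrite eqxx (negPf (ord0_prefix_set _ _)).
Qed.

Definition perm_gallery m p (s : 'S_m) k : 'S_m.+1 := forest p (prefix_set s k) m.

Definition perm_chain m p (s : 'S_m) : {set 'S_m.+1} := chain_of (perm_gallery p s).

(** As the grafts of a tree give the long cycle only if its edges do not cross,
    the second condition expresses that the tree is noncrossing. *)
Definition noncrossing_tree m (p : 'I_m.+1 -> 'I_m.+1) : Prop :=
  (forall j : 'I_m.+1, 0 < j -> p j < j) /\
  forest p [set~ ord0] m = long_cycle m.+1.

Lemma perm_gallery_excv m p (s : 'S_m) k : noncrossing_tree p ->
  excv (perm_gallery p s k) = prefix_set s k.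
Proof. by case=> p_lt pc; apply: forest_excvE => //; apply: ord0_prefix_set. Qed.

Lemma perm_gallery_gallery m p (s : 'S_m) : noncrossing_tree p -> gallery (perm_gallery p s).
Proof.
case=> p_lt pc; split=> [||k lt_km]; rewrite /perm_gallery.
- rewrite prefix_set0 (@forest_stable _ p _ 0 m) // => i; by rewrite inE.
- by rewrite prefix_set_full.
- by rewrite (prefix_setS s (Ordinal lt_km)); apply: forest_setU1.
Qed.

Lemma perm_gallery_label m p (s : 'S_m) (i : 'I_m) : noncrossing_tree p ->
  label (perm_gallery p s) i = lift ord0 (s i).
Proof.
move=> pD; apply: label_eq; split.
- by have [_ _ XS] := perm_gallery_gallery s pD; apply: XS.
- by rewrite perm_gallery_excv // mem_prefix_set ltnn.
- by rewrite !perm_gallery_excv // prefix_setS.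
Qed.

Lemma perm_chain_max m p (s : 'S_m) : noncrossing_tree p ->
  perm_chain p s \in max_chains m.+1.
Proof. by move=> pD; apply/chain_of_max/perm_gallery_gallery. Qed.

Lemma perm_chain_inj m p : noncrossing_tree p -> injective (@perm_chain m p).
Proof.
move=> pD s t eq_st; apply/permP=> i; apply: (@lift_inj _ ord0).
rewrite -!(perm_gallery_label _ _ pD) /label.
have eqk k : k <= m -> perm_gallery p s k = perm_gallery p t k.
  move=> le_km; rewrite -(rank_elt_chain_of (perm_gallery_gallery s pD) le_km).
  rewrite -(rank_elt_chain_of (perm_gallery_gallery t pD) le_km).
  by rewrite -/(perm_chain p t) -eq_st.
by rewrite !eqk // ltnW.
Qed.

(** Position pairs i < j with s j < s i correspond to the value pairs
    (s j, s i). *)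
Lemma perm_chain_inv m p (s : 'S_m) : noncrossing_tree p ->
  #|chain_inv (perm_chain p s)| = inversions s.
Proof.
move=> pD; rewrite /inversions.
pose h (ij : 'I_m * 'I_m) := (lift ord0 (s ij.2), lift ord0 (s ij.1)).
have h_inj : injective h.
  move=> [i j] [i' j'] /eqP; rewrite xpair_eqE !(inj_eq lift_inj) !(inj_eq perm_inj).
  by case/andP=> /eqP /= -> /eqP /= ->.
rewrite -(card_imset _ h_inj); apply: eq_card => -[a b].
apply/chain_invP/imsetP => [[a0 ab [k [le_km bX aX]]]|[[i j]]].
  rewrite !perm_gallery_excv // in bX aX.
  case: (unliftP ord0 a) a0 ab aX => [a'|] -> // _ ab aX.
  case: (unliftP ord0 b) ab bX => [b'|] -> // ab bX.
  exists (s^-1%g b', s^-1%g a'); last by rewrite /h /= !permKV.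
  move: aX bX ab; rewrite -{1}(permKV s a') -{1}(permKV s b') !mem_prefix_set inE /= !permKV.
  by rewrite -leqNgt /bump !leq0n /=; lia.
rewrite inE /= => /andP[ij sji] [-> ->]; split.
- by rewrite lift0.
- by rewrite !lift0.
by exists j; rewrite !perm_gallery_excv // !mem_prefix_set ij ltnn ltnW.
Qed.

(** * The isomorphism *)

Definition swapped m (s : 'S_m) (j : 'I_m.-1) : 'S_m := pmul s (@simple_transp m j).

Lemma ltn_ord_predS m (j : 'I_m.-1) : j.+1 < m.
Proof. by have := ltn_ord j; lia. Qed.

Lemma swapped_prefix_set m (s : 'S_m) (j : 'I_m.-1) k :
  k != j.+1 -> prefix_set (swapped s j) k = prefix_set s k.
Proof.
move=> kj; apply/setP=> x; case: (unliftP ord0 x) => [l|] ->; last first.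
  by rewrite !(negPf (ord0_prefix_set _ _)).
pose t := @simple_transp m j.
have t_k (i : 'I_m) : (t i < k) = (i < k).
  by rewrite /t simple_transpE; repeat case: ifP; lia.
have [i l_i] : exists i, l = swapped s j i by exists ((swapped s j)^-1%g l); rewrite permKV.
by rewrite l_i mem_prefix_set /swapped /pmul permM mem_prefix_set t_k.
Qed.

Lemma swapped_agree m (s : 'S_m) (j : 'I_m.-1) p :
  agree_off j.+1 (perm_gallery p s) (perm_gallery p (swapped s j)).
Proof. by move=> k _ kj; rewrite /perm_gallery swapped_prefix_set. Qed.

Lemma swapped_label m (s : 'S_m) (j : 'I_m.-1) p : noncrossing_tree p ->
  label (perm_gallery p (swapped s j)) j = label (perm_gallery p s) j.+1.
Proof.
move=> pD; have lt_jm := ltn_ord_predS j.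
rewrite (perm_gallery_label (swapped s j) (Ordinal (ltnW lt_jm)) pD).
rewrite (perm_gallery_label s (Ordinal lt_jm) pD) /swapped /pmul permM.
by congr (lift ord0 (s _)); apply: val_inj; rewrite /= simple_transpE eqxx.
Qed.

Lemma swapped_labelS m (s : 'S_m) (j : 'I_m.-1) p : noncrossing_tree p ->
  label (perm_gallery p (swapped s j)) j.+1 = label (perm_gallery p s) j.
Proof.
move=> pD; have lt_jm := ltn_ord_predS j.
rewrite (perm_gallery_label s (Ordinal (ltnW lt_jm)) pD).
rewrite (perm_gallery_label (swapped s j) (Ordinal lt_jm) pD) /swapped /pmul permM.
congr (lift ord0 (s _)); apply: val_inj.
by rewrite /= simple_transpE /= eqxx gtn_eqF.
Qed.

Lemma swappedK m (s : 'S_m) (j : 'I_m.-1) : swapped (swapped s j) j = s.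
Proof. by rewrite /swapped /pmul /simple_transp mulgA tperm2 mul1g. Qed.

Lemma weak_cover_chain m p (s t : 'S_m) : noncrossing_tree p ->
  weak_cover s t -> weak_coverF (perm_chain p s) (perm_chain p t).
Proof.
move=> pD /existsP[j /andP[/eqP t_s /eqP inv_t]].
rewrite /weak_coverF !perm_chain_inv // inv_t eqxx andbT t_s.
have galS := perm_gallery_gallery s pD.
apply: (exchange_adj galS (perm_gallery_gallery _ pD) (ltn_ord_predS j)).
  exact: swapped_agree.
exact: swapped_label.
Qed.

(** Below the chain of t, an edge undoes a descent of t, and the resulting
    element of rank k.+1 is the unique one with ascending labels; it is therefore
    the one of the permutation obtained from t by the same exchange. *)
Lemma weak_coverF_chain m p (u : {set 'S_m.+1}) (t : 'S_m) : noncrossing_tree p ->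
    weak_coverF u (perm_chain p t) ->
  exists2 s, u = perm_chain p s & weak_cover s t.
Proof.
move=> pD cov_ut; have /andP[adj_ut /eqP inv_t] := cov_ut.
have /and4P[uM _ _ _] := adj_ut; have [galX Xu] := max_chain_gallery uM.
have galT := perm_gallery_gallery t pD.
move: adj_ut inv_t; rewrite -{}Xu; move: (rank_elt u) galX => X galX adj_ut inv_t.
have [|[_ [k [lt_km XT lt_lab Tk Tk1]]]] := adj_chain_inv galX galT adj_ut.
  by rewrite -/(perm_chain p t) inv_t ltnn.
have lt_k : k < m.-1 by lia.
pose j := Ordinal lt_k; pose s := swapped t j.
have galS := perm_gallery_gallery s pD.
have TS := @swapped_agree _ t j p.
have off l : l <= m -> l != k.+1 -> perm_gallery p s l = X l.
  by move=> le_lm lk; rewrite XT // TS.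
have Sk : label (perm_gallery p s) k = label X k by rewrite (swapped_label t j).
have Sk1 : label (perm_gallery p s) k.+1 = label X k.+1.
  by rewrite (swapped_labelS t j).
have lt_km' := ltnW lt_km.
have eqXS : chain_of X = perm_chain p s.
  apply: eq_chain_of => l le_lm; have [->|lk] := eqVneq l k.+1; last by rewrite off.
  have := gallery_step galX lt_km; have := gallery_step galX lt_km'.
  have := gallery_step galS lt_km; have := gallery_step galS lt_km'.
  rewrite Sk Sk1 (off k) ?(off k.+2) ?neq_ltn ?ltnSn ?orbT ?(ltnW lt_km') //.
  move=> S1 S2 X1 X2; rewrite (ascent_unique lt_lab X1 X2).
  by rewrite (ascent_unique lt_lab S1 S2).
exists s => //; apply/existsP; exists j; rewrite -/(swapped s j) swappedK eqxx /=.
by rewrite -!(perm_chain_inv _ pD) -eqXS inv_t.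
Qed.

Lemma weak_le_chain m p (s t : 'S_m) : noncrossing_tree p ->
  weak_le s t -> connect (@weak_coverF m) (perm_chain p s) (perm_chain p t).
Proof.
move=> pD /connectP[q q_path ->]; apply/connectP; exists (map (perm_chain p) q).
  by rewrite (homo_path _ q_path) // => x y; apply: weak_cover_chain.
by rewrite last_map.
Qed.

Lemma connect_chain m p (u : {set 'S_m.+1}) (t : 'S_m) : noncrossing_tree p ->
    connect (@weak_coverF m) u (perm_chain p t) ->
  exists2 s, u = perm_chain p s & weak_le s t.
Proof.
move=> pD /connectP[q]; elim: q u => [|v q IHq] u /=.
  by move=> _ <-; exists t => //; apply: connect0.
case/andP=> uv /IHq{}IHq /IHq[r v_r rt]; rewrite v_r in uv.
have [s u_s sr] := weak_coverF_chain pD uv; exists s => //.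
exact: connect_trans (connect1 sr) rt.
Qed.

(** A permutation above s with the largest number of inversions has no ascent, so
    that its initial segments are the sets of the largest labels. *)
Lemma perm_chain_top m (X : nat -> 'S_m.+1) (s : 'S_m) : gallery X ->
    (forall k, k.+1 < m -> label X k.+1 < label X k) -> noncrossing_tree (parent X) ->
  exists2 t, weak_le s t & perm_chain (parent X) t = chain_of X.
Proof.
move=> galX decX pD; set p := parent X in pD *.
have le_ss : weak_le s s by apply: connect0.
case: (arg_maxnP (@inversions m) le_ss) => t le_st max_t; exists t => //.
have galT := perm_gallery_gallery t pD.
(* An ascent of t would allow an exchange with one inversion more. *)
have decT k : k.+1 < m ->
    label (perm_gallery p t) k.+1 < label (perm_gallery p t) k.
  move=> lt_km; rewrite ltnNge leq_eqVlt.
  apply/negP=> /orP[/eqP/val_inj eq_lab|lt_lab].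
    by have := label_neq galT lt_km; rewrite eq_lab eqxx.
  have lt_k : k < m.-1 by lia.
  pose j := Ordinal lt_k; pose r := swapped t j.
  have := exchange_cover galT (perm_gallery_gallery r pD) lt_km.
  move/(_ (@swapped_agree _ t j p) lt_lab (swapped_label t j pD)).
  rewrite /weak_coverF -!/(perm_chain _ _) !perm_chain_inv // => /andP[_ inv_r].
  have tr : weak_cover t r by apply/existsP; exists j; rewrite inv_r andbT.
  have := max_t r (connect_trans le_st (connect1 tr)).
  by rewrite (eqP inv_r) /= ltnn.
apply: eq_chain_of => k le_km.
have prefix_setE : prefix_set t k = [set i : 'I_m.+1 | m - k < i].
  by rewrite -(perm_gallery_excv t k pD); apply: descending_excv.
rewrite /perm_gallery prefix_setE (@forest_stable _ _ _ k m) //.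
  by apply: forest_parent => // i; rewrite inE.
by move=> i; rewrite inE.
Qed.

Theorem theorem5p9 (n : nat) (n_ge1 : 1 <= n) (w0 : {set 'S_n})
    (w0_max : weakF_maximal w0) :
  exists f : 'S_(n.-1) -> {set 'S_n},
    poset_iso_onto (@weak_le n.-1) (@weakF_le n)
      (fun u => u \in max_chains n /\ weakF_le u w0) f.
Proof.
case: n n_ge1 w0 w0_max => // m _ w0 w0_max.
have decX := maximal_descending w0_max.
have [galX Xw0] := max_chain_gallery w0_max.1.
move: (rank_elt w0) Xw0 galX decX => X Xw0 galX decX; pose p := parent X.
have pD : noncrossing_tree p.
  split=> [j|]; first exact: parent_lt.
  rewrite (@eq_forest _ _ _ setT) // => [|i]; last first.
    by rewrite subnn !inE -val_eqE lt0n => ->.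
  rewrite forest_parent //; last by move=> i; rewrite inE.
  by case: galX.
exists (perm_chain p); split=> [|u|s t]; first exact: perm_chain_inj.
  split=> [[_ /weakF_leE[_ u_w0]]|[s <-]].
    have [t _ t_top] := perm_chain_top 1%g galX decX pD.
    move: u_w0; rewrite -Xw0 -t_top => /(connect_chain pD)[s u_s _].
    by exists s.
  have sM := perm_chain_max s pD; split=> //; apply/weakF_leE; split=> //.
  have [t st t_top] := perm_chain_top s galX decX pD.
  by rewrite -Xw0 -t_top; apply: weak_le_chain.
split=> [st|/weakF_leE[_ /(connect_chain pD)[r /(perm_chain_inj pD)<- //]]].
apply/weakF_leE; split; [exact: perm_chain_max | exact: weak_le_chain].
Qed.
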